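(* Assume (A1)–(A4) from the context. Let $T\ge 1$, and let the step sizes $\alpha,\beta>0$ satisfy $$0<\alpha(\rho+L)+4\alpha^2L^2\le \tfrac12 \qquad\text{and}\qquad 192(6+\delta)\beta^2K^2L^2\le 1,\qquad \text{where } \delta=\frac{1}{(1-\alpha\rho)^2}.$$ Then the iterates $z^0,\dots,z^{T-1}$ generated by FedCanon satisfy $$\frac{1}{T}\sum_{t=0}^{T-1}\mathbb{E}\Vert G^{\alpha}(z^{t})\Vert^2\le \frac{8\left[\phi(z^0)-\phi^*+\alpha\mathcal{E}^0\right]}{\alpha T}+\frac{50\sigma^2}{BK}+\frac{\sigma^2}{8B}+B_h .$$
   Context: Let $N,d,K,B$ be positive integers and $[N]=\{1,\dots,N\}$. For each client $i\in[N]$ let $f_i(x)=\mathbb{E}_{\xi\sim\mathcal{D}_i}[F_i(x;\xi)]$. Let $f=\frac1N\sum_{i=1}^N f_i$, let $h:\mathbb{R}^d\to\mathbb{R}\cup\{+\infty\}$, and let $\phi=f+h$. No similarity between the distributions $\mathcal{D}_i$ is assumed. Standing assumptions: (A1) $\phi^*:=\inf_z\phi(z)>-\infty$. (A2) There is $L>0$ such that for every $i$ and all $x,y$: $f_i(x)-f_i(y)-\langle\nabla f_i(y),x-y\rangle\le \frac L2\Vert x-y\Vert^2$ and $\Vert\nabla f_i(x)-\nabla f_i(y)\Vert\le L\Vert x-y\Vert$. (A3) $h$ is proper, closed and $\rho$-weakly convex for some $\rho\ge0$, i.e. $h(z)+\frac{\rho}{2}\Vert z\Vert^2$ is convex; it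 need not be smooth. There is a constant $B_h$ such that $\Vert h'(z)\Vert^2\le B_h$ for every $z$ and every subgradient $h'(z)\in\partial h(z)$. (A4) Whenever client $i$ evaluates a stochastic gradient $g_i(x)$, it draws $B$ fresh samples $\xi_{i,1},\dots,\xi_{i,B}\sim\mathcal{D}_i$, independent of everything drawn before, and sets $g_i(x)=\frac1B\sum_{b=1}^B\nabla F_i(x;\xi_{i,b})$. Conditionally on the past, $\mathbb{E}[g_i(x)]=\nabla f_i(x)$ and $\mathbb{E}\Vert g_i(x)-\nabla f_i(x)\Vert^2\le\sigma^2/B$. Proximal operator: $\mathbf{prox}_{\alpha h}\{y\}=\arg\min_x\{h(x)+\frac{1}{2\alpha}\Vert x-y\Vert^2\}$. Algorithm FedCanon. The inputs are step sizes $\alpha,\beta>0$, an initial point $z^0\in\mathbb{R}^d$, and control variables $c_i^0\in\mathbb{R}^d$ with $\sum_{i}c_i^0=\mathbf{0}_d$. For $t=0,1,\dots$: - every client $i$ sets $\hat x_i^{t,0}=z^t$; - for $k=0,\dots,K-1$ it updates $\hat x_i^{t,k+1}=\hat x_i^{t,k}-\beta[g_i(\hat x_i^{t,k})+c_i^t]$; - it forms $\Delta_i^{t+1}=\frac{1}{\beta K}(z^t-\hat x_i^{t,K})$; - the server computes $\bar\Delta^{t+1}=\frac1N\sum_i\Delta_i^{t+1}$ and $z^{t+1}=\mathbf{prox}_{\alpha h}\{z^t-\alpha\bar\Delta^{t+1}\}$; - every client updates $c_i^{t+1}=c_i^t+\bar\Delta^{t+1}-\Delta_i^{t+1}$. (The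 variant FedCanon II, in which every client applies the prox step locally starting from a common initialization, generates the same sequence.) Notation: - $G^{\alpha}(z,u)=\frac1\alpha\left(z-\mathbf{prox}_{\alpha h}\{z-\alpha u\}\right)$, and the proximal gradient is $G^\alpha(z)=G^\alpha(z,\nabla f(z))$. - $v_i^t=\frac1K\sum_{k=0}^{K-1}g_i(\hat x_i^{t,k})$ and $\bar v^t=\frac1N\sum_i v_i^t$. - $\mathcal{E}^t=\frac1N\sum_{i=1}^N\mathbb{E}\Vert\nabla f_i(z^t)+c_i^t-\nabla f(z^t)\Vert^2$. For $t\ge1$ this equals $\frac1N\sum_i\mathbb{E}\Vert\nabla f_i(\hat x_i^{t,0})-v_i^{t-1}-\nabla f(z^t)+\bar v^{t-1}\Vert^2$, since $c_i^t=\bar v^{t-1}-v_i^{t-1}$. - $\mathbb{E}$ denotes expectation over all sampling. *)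

(* Defs.v *)
From mathcomp Require Import all_boot all_order all_algebra.
From mathcomp Require Import all_classical all_reals all_analysis.
Import numFieldNormedType.Exports.
Import Order.TTheory GRing.Theory Num.Theory.

Set Implicit Arguments.
Unset Strict Implicit.
Unset Printing Implicit Defensive.

Local Open Scope classical_set_scope.
Local Open Scope ring_scope.

Section FedCanonDefs.
Variables (R : realType) (d : nat).
Notation vec := 'rV[R]_d.

Definition dot (u v : vec) : R := \sum_(j < d) u ord0 j * v ord0 j.
Definition sqn (u : vec) : R := dot u u.
Definition nrm (u : vec) : R := Num.sqrt (sqn u).

Definition prox (a : R) (h : vec -> \bar R) (y : vec) : vec :=
  xget 0 [set x | forall x' : vec,
     (h x + ((2 * a)^-1 * sqn (x - y))%:E <= h x' + ((2 * a)^-1 * sqn (x' - y))%:E)%E].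

Definition Gmap (a : R) (h : vec -> \bar R) (z u : vec) : vec :=
  a^-1 *: (z - prox a h (z - a *: u)).

Definition proper_fun (h : vec -> \bar R) : Prop :=
  (forall x, h x != -oo%E) /\ exists x, h x \is a fin_num.

Definition closed_fun (h : vec -> \bar R) : Prop :=
  closed [set p : vec * R | (h p.1 <= p.2%:E)%E].

Definition weakly_convex (rho : R) (h : vec -> \bar R) : Prop :=
  forall (x y : vec) (l : R), 0 < l < 1 ->
    let m := (l *: x + (1 - l) *: y)%R in
    (h m + (rho / 2 * sqn m)%:E
     <= l%:E * (h x + (rho / 2 * sqn x)%:E) + (1 - l)%:E * (h y + (rho / 2 * sqn y)%:E))%E.

Definition subgrad (h : vec -> \bar R) (z v : vec) : Prop :=
  h z \is a fin_num /\
  forall eps : R, 0 < eps -> exists2 delta : R, 0 < delta &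
    forall y : vec, nrm (y - z) < delta ->
      (h z + (dot v (y - z) - eps * nrm (y - z))%:E <= h y)%E.

Definition is_gradient (f : vec -> R) (g : vec -> vec) : Prop :=
  forall x : vec, differentiable f x /\ forall v : vec, 'd f x v = dot (g x) v.

(* gs i t k x = stochastic gradient g_i(x) used by client i in round t, local step k *)
Variables (N K : nat) (alpha beta : R) (h : vec -> \bar R)
          (gs : 'I_N -> nat -> nat -> vec -> vec).

Fixpoint local_iter (i : 'I_N) (t : nat) (c z : vec) (k : nat) : vec :=
  match k with
  | 0 => z
  | k'.+1 => let x := local_iter i t c z k' in x - beta *: (gs i t k' x + c)
  end.

Definition Delta (i : 'I_N) (t : nat) (c z : vec) : vec :=
  (beta * K%:R)^-1 *: (z - local_iter i t c z K).

Definition fedcanon_round (t : nat) (st : vec * ('I_N -> vec)) : vec * ('I_N -> vec) :=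
  let z := st.1 in let c := st.2 in
  let Dbar := (N%:R)^-1 *: \sum_(i < N) Delta i t (c i) z in
  (prox alpha h (z - alpha *: Dbar), fun i => c i + Dbar - Delta i t (c i) z).

Fixpoint fedcanon (z0 : vec) (c0 : 'I_N -> vec) (t : nat) : vec * ('I_N -> vec) :=
  match t with
  | 0 => (z0, c0)
  | t'.+1 => fedcanon_round t' (fedcanon z0 c0 t')
  end.

End FedCanonDefs.

Definition minibatch_grad {R : realType} {d : nat} {dO : measure_display}
  {Om : measurableType dO} {Xi : Type} {N B : nat}
  (gF : 'I_N -> 'rV[R]_d -> Xi -> 'rV[R]_d)
  (xi : 'I_N -> nat -> nat -> 'I_B -> Om -> Xi) (w : Om)
  : 'I_N -> nat -> nat -> 'rV[R]_d -> 'rV[R]_d :=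
  fun i t k x => (B%:R)^-1 *: \sum_(b < B) gF i x (xi i t k b w).

Definition iid_samples {R : realType} {dO dX : measure_display}
  {Om : measurableType dO} {Xi : measurableType dX} {N B : nat} (K : nat)
  (P : probability Om R) (D : 'I_N -> probability Xi R)
  (xi : 'I_N -> nat -> nat -> 'I_B -> Om -> Xi) : Prop :=
  (forall i t k b, measurable_fun setT (xi i t k b)) /\
  forall (s : seq ('I_N * nat * nat * 'I_B)) (A : 'I_N * nat * nat * 'I_B -> set Xi),
    uniq s ->
    (forall j, j \in s -> (j.1.2 < K)%N) ->
    (forall j, measurable (A j)) ->
    P (\bigcap_(j in [set` s]) (xi j.1.1.1 j.1.1.2 j.1.2 j.2 @^-1` A j))
    = (\prod_(j <- s) D j.1.1.1 (A j))%E.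

(* Main.v *)
Require Import Defs.
From HB Require Import structures.
From mathcomp Require Import all_boot all_order all_algebra.
From mathcomp Require Import all_classical all_reals all_analysis.
From mathcomp Require Import measurable_realfun ring lra.
Import numFieldNormedType.Exports.
Import Order.TTheory GRing.Theory Num.Theory.
Local Open Scope classical_set_scope.
Local Open Scope ring_scope.

Set Implicit Arguments.
Unset Strict Implicit.
Unset Printing Implicit Defensive.

(** Every estimate is made pathwise except one. With the Lyapunov function
    phi(z) + (alpha / 16) E(z, c), where E is the heterogeneity
    avg_i |grad f_i(z) + c_i - grad f(z)|^2, each round satisfies, for every
    realization of the samples,
      |G(z_t)|^2 <= (8 / alpha) (Lyap_t - Lyap_{t+1}) + 50 M_t + Q_t / 8 + B_h,
    where M_t and Q_t average squared norms of partial sums of the gradient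
    noise along the local steps. The client drift contains |grad f(z)|^2, which
    is at most 2 |G|^2 + 2 B_h since G - grad f is a subgradient of h at the
    proximal point. Telescoping needs no integrability of phi(z_t). Only
    E M_t, E Q_t <= sigma^2 / (B K) is probabilistic: adding one fresh centred
    gradient to a vector determined by the other samples raises the second
    moment by at most sigma^2, by Tonelli on (Omega, other samples) x Xi. *)

(** * Euclidean geometry *)

(** Since [h] is not assumed bounded below, even the existence of prox points is a claim. (A1) and
    the smoothness of the average loss give [h] a quadratic minorant of curvature [L], and the
    condition on [alpha] yields [alpha * L <= 1 / 2]. The same condition yields
    [alpha * rho <= 1 / 2], which makes the prox Lipschitz.

    Independence is used without a filtration: for a given sample, the past is the sigma-algebra
    generated by all other samples up to the current round, a second measurable structure on the
    carrier of Omega. The measurability lemmas on iterates and noise are therefore stated over an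
    arbitrary measurable space and serve both structures.

    The condition on [beta] acts only through [(beta * K * L)^2 <= 1 / 1344], where 1344 = 192 * 7
    comes from [delta >= 1]. *)

Section Euclid.
Context {R : realType} {d : nat}.
Implicit Types (u v w : 'rV[R]_d) (a : R).

Lemma dotC u v : dot u v = dot v u.
Proof. by apply: eq_bigr => j _; rewrite mulrC. Qed.

Lemma dotDl u v w : dot (u + v) w = dot u w + dot v w.
Proof. by rewrite -big_split; apply: eq_bigr => j _; rewrite mxE mulrDl. Qed.

Lemma dotZl a u v : dot (a *: u) v = a * dot u v.
Proof. by rewrite /dot big_distrr/=; apply: eq_bigr => j _; rewrite mxE mulrA. Qed.

Lemma dotNl u v : dot (- u) v = - dot u v.
Proof. by rewrite -scaleN1r dotZl mulN1r. Qed.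

Lemma dotDr u v w : dot w (u + v) = dot w u + dot w v.
Proof. by rewrite dotC dotDl !(dotC w). Qed.

Lemma dotZr a u v : dot v (a *: u) = a * dot v u.
Proof. by rewrite dotC dotZl dotC. Qed.

Lemma dotNr u v : dot v (- u) = - dot v u.
Proof. by rewrite dotC dotNl dotC. Qed.

Definition dotE := (dotDl, dotDr, dotNl, dotNr, dotZl, dotZr).

Lemma dot0l u : dot 0 u = 0.
Proof. by rewrite -(scale0r u) dotZl mul0r. Qed.

Lemma dot_suml I (r : seq I) (P : pred I) (x : I -> 'rV[R]_d) v :
  dot (\sum_(i <- r | P i) x i) v = \sum_(i <- r | P i) dot (x i) v.
Proof. by elim/big_rec2: _ => [|i a b _ <-]; rewrite ?dot0l ?dotDl. Qed.

Lemma sqn_ge0 u : 0 <= sqn u.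
Proof. by apply: sumr_ge0 => j _; rewrite -expr2 sqr_ge0. Qed.

Lemma sqn0 : sqn (0 : 'rV[R]_d) = 0.
Proof. exact: dot0l. Qed.

Lemma sqnZ a u : sqn (a *: u) = a ^+ 2 * sqn u.
Proof. by rewrite /sqn !dotE; ring. Qed.

Lemma sqnN u : sqn (- u) = sqn u.
Proof. by rewrite /sqn !dotE; ring. Qed.

Lemma sqnD u v : sqn (u + v) = sqn u + 2 * dot u v + sqn v.
Proof. by rewrite /sqn !dotE (dotC v u); ring. Qed.

Lemma sqnB u v : sqn (u - v) = sqn u - 2 * dot u v + sqn v.
Proof. by rewrite sqnD sqnN dotNr; ring. Qed.

Lemma sqnBC u v : sqn (u - v) = sqn (v - u).
Proof. by rewrite -sqnN opprB. Qed.

Lemma dot_young a u v : 0 < a -> dot u v <= a / 2 * sqn u + (2 * a)^-1 * sqn v.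
Proof.
move=> a0; have := sqn_ge0 (a *: u - v); rewrite sqnB sqnZ dotZl => H.
have -> : a / 2 * sqn u + (2 * a)^-1 * sqn v
  = (2 * a)^-1 * (a ^+ 2 * sqn u - 2 * (a * dot u v) + sqn v) + dot u v.
  by field; rewrite gt_eqF.
by rewrite lerDr mulr_ge0// invr_ge0 mulr_ge0// ltW.
Qed.

Lemma sqnD_le2 u v : sqn (u + v) <= 2 * sqn u + 2 * sqn v.
Proof. by rewrite sqnD; have := dot_young u v (@ltr01 R); lra. Qed.

Lemma sqn_sum_le I (r : seq I) (x : I -> 'rV[R]_d) :
  sqn (\sum_(i <- r) x i) <= (size r)%:R * \sum_(i <- r) sqn (x i).
Proof.
elim: r => [|i r IH]; first by rewrite !big_nil sqn0 mulr0.
rewrite !big_cons sqnD /= -natr1.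
suff : 2 * dot (x i) (\sum_(j <- r) x j)
       <= (size r)%:R * sqn (x i) + \sum_(j <- r) sqn (x j) by lra.
rewrite dotC dot_suml big_distrr/=.
clear IH; elim: r => [|j r IH]; first by rewrite !big_nil mul0r addr0.
rewrite !big_cons /= -natr1.
by have := dot_young (x j) (x i) (@ltr01 R); lra.
Qed.

Lemma sqn_sum_ord_le n (x : 'I_n -> 'rV[R]_d) :
  sqn (\sum_(i < n) x i) <= n%:R * \sum_(i < n) sqn (x i).
Proof.
by have := sqn_sum_le (enum 'I_n) x; rewrite size_enum_ord !big_enum.
Qed.

Lemma sqn_avg_le n (x : 'I_n -> 'rV[R]_d) : (0 < n)%N ->
  sqn (n%:R^-1 *: \sum_(i < n) x i) <= n%:R^-1 * \sum_(i < n) sqn (x i).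
Proof.
move=> n0; have n0' : 0 < n%:R :> R by rewrite ltr0n.
rewrite sqnZ expr2 -mulrA ler_pM2l ?invr_gt0// mulrC ler_pdivrMr// mulrC.
exact: sqn_sum_ord_le.
Qed.

Lemma variance_decomp n (x : 'I_n -> 'rV[R]_d) : (0 < n)%N ->
  let m := n%:R^-1 *: \sum_(i < n) x i in
  n%:R^-1 * \sum_(i < n) sqn (x i) = n%:R^-1 * \sum_(i < n) sqn (x i - m) + sqn m.
Proof.
move=> n0 m; have n0' : n%:R != 0 :> R by rewrite pnatr_eq0 -lt0n.
have -> : \sum_(i < n) sqn (x i - m)
    = \sum_(i < n) sqn (x i) - 2 * dot (\sum_(i < n) x i) m + n%:R * sqn m.
  rewrite dot_suml big_distrr/= -sumrB.
  have -> : n%:R * sqn m = \sum_(i < n) sqn m by rewrite sumr_const card_ord mulr_natl.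
  by rewrite -big_split; apply: eq_bigr => i _; rewrite sqnB.
have -> : \sum_(i < n) x i = n%:R *: m by rewrite scalerA divff// scale1r.
by rewrite dotZl /sqn; field.
Qed.

Lemma sqn_le_nrm u v a : 0 <= a -> nrm u <= a * nrm v -> sqn u <= a ^+ 2 * sqn v.
Proof.
move=> a0; rewrite /nrm => H.
rewrite -(sqr_sqrtr (sqn_ge0 u)) -(sqr_sqrtr (sqn_ge0 v)) -exprMn.
by rewrite ler_pXn2r ?nnegrE ?mulr_ge0 ?sqrtr_ge0.
Qed.

Lemma nrm_sqr u : nrm u ^+ 2 = sqn u.
Proof. by rewrite sqr_sqrtr ?sqn_ge0. Qed.

End Euclid.

(** * The proximal operator *)

Section Continuity.
Context {R : realType} {d : nat}.

Lemma sqn_continuous : continuous (@sqn R d).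
Proof.
move=> x; rewrite /sqn /dot.
apply: (@cvg_big _ _ _ _ _ _ _ (nbhs x)) => [|j _]; first exact: add_continuous.
by apply: cvgM; exact: coord_continuous.
Qed.

End Continuity.

Section Prox.
Context {R : realType} {d : nat} (h : 'rV[R]_d -> \bar R) (a : R).
Hypothesis a_gt0 : 0 < a.

Definition prox_obj (y x : 'rV[R]_d) : \bar R :=
  (h x + ((2 * a)^-1 * sqn (x - y))%:E)%E.

(* A quadratic minorant of curvature below 1/a makes the prox objective
   coercive, so its infimum is attained on a compact piece of the epigraph. *)
Lemma prox_objP (y g : 'rV[R]_d) (b L : R) :
  proper_fun h -> closed_fun h -> a * L <= 1 / 2 ->
  (forall x, ((b - dot g (x - y) - L / 2 * sqn (x - y))%:E <= h x)%E) ->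
  forall x', (prox_obj y (prox a h y) <= prox_obj y x')%E.
Proof.
move=> [hNy [x0 x0fin]] hcl aL hlb.
(* [prox] selects by [xget] with default 0, so it satisfies the bound as soon as some minimiser
   exists. *)
suff ex : exists x, forall x', (prox_obj y x <= prox_obj y x')%E.
  by rewrite /prox; case: xgetP => [x _ //|/(_ _)]; case: ex => x Hx /(_ x) [].
pose q (x : 'rV[R]_d) := (2 * a)^-1 * sqn (x - y).
pose lb := b - 2 * a * sqn g.
(* With c = 1/(8a): the proximal term offers 4c, the curvature of the minorant takes at most 2c,
   Young on the linear term takes c and costs [2 * a * sqn g]; c is left. *)
have coer (x : 'rV[R]_d) (r : R) : (h x <= r%:E)%E ->
    lb + (8 * a)^-1 * sqn (x - y) <= r + q x.
  move=> /(le_trans (hlb x)); rewrite lee_fin => H.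
  have a4 : 0 < (4 * a)^-1 by rewrite invr_gt0 mulr_gt0.
  have := dot_young (x - y) g a4.
  rewrite dotC => Y.
  have aL' : L / 2 * sqn (x - y) <= (4 * a)^-1 * sqn (x - y).
    apply: ler_wpM2r; first exact: sqn_ge0.
    have -> : (4 * a)^-1 = (1 / 2) / a / 2 by field; rewrite gt_eqF.
    by rewrite ler_pM2r ?invr_gt0// ler_pdivlMr// mulrC.
  have e1 : (4 * a)^-1 = 2 * (8 * a)^-1 by field; rewrite gt_eqF.
  have e2 : (2 * a)^-1 = 4 * (8 * a)^-1 by field; rewrite gt_eqF.
  have e3 : (2 * (4 * a)^-1)^-1 = 2 * a by field; rewrite gt_eqF.
  rewrite /lb /q; move: Y aL' H; rewrite e3 e1 e2 -!mulrA.
  set s := sqn _; set c := (8 * a)^-1; set s' := sqn g.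
  by move=> Y aL' H; lra.
pose m0 := fine (h x0) + q x0.
have hx0 : (h x0 <= (fine (h x0))%:E)%E by rewrite fineK.
pose M := 8 * a * (m0 - lb).
have M0 : 0 <= M.
  have := coer _ _ hx0; rewrite -/m0 => H.
  rewrite mulr_ge0 ?mulr_ge0 ?(ltW a_gt0)// subr_ge0 (le_trans _ H)// lerDl.
  by rewrite mulr_ge0 ?sqn_ge0// invr_ge0 mulr_ge0// ltW.
have inM x r : (h x <= r%:E)%E -> r + q x <= m0 -> sqn (x - y) <= M.
  move=> hx rm; have := le_trans (coer _ _ hx) rm.
  rewrite -lerBrDl => H.
  by rewrite -ler_pdivrMl// mulr_gt0.
have inr x r : (h x <= r%:E)%E -> r + q x <= m0 -> lb - (2 * a)^-1 * M <= r <= m0.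
  move=> hx rm; have sM := inM _ _ hx rm.
  have a2 : 0 < (2 * a)^-1 by rewrite invr_gt0 mulr_gt0.
  have qM : q x <= (2 * a)^-1 * M by rewrite ler_pM2l.
  have q0 : 0 <= q x by rewrite mulr_ge0 ?sqn_ge0// ltW.
  have := coer _ _ hx.
  have : 0 <= (8 * a)^-1 * sqn (x - y).
    by rewrite mulr_ge0 ?sqn_ge0// invr_ge0 mulr_ge0// ltW.
  by lra.
(* [h] is extended-valued and only lower semicontinuous, so the minimum is taken over epigraph pairs
   (x, r), where the objective r + q x is continuous and the constraint closed. The half-width M + 1
   avoids a square root: s^2 <= M forces |s| <= M + 1. *)
pose C := [set p : 'rV[R]_d * R | (h p.1 <= p.2%:E)%E] `&`
  ([set x : 'rV[R]_d | forall j, `[y ord0 j - (M + 1), y ord0 j + (M + 1)]%classic (x ord0 j)]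
   `*` `[lb - (2 * a)^-1 * M, m0]%classic).
have Ccomp : compact C.
  rewrite /C setIC; apply: compact_closedI; last exact: hcl.
  apply: compact_setX; last exact: segment_compact.
  apply: (@rV_compact R d (fun j => `[y ord0 j - (M + 1), y ord0 j + (M + 1)]%classic)) => j.
  exact: segment_compact.
have inC x r : (h x <= r%:E)%E -> r + q x <= m0 -> C (x, r).
  move=> hx rm; split => //=; split => /=; last by rewrite in_itv/=; exact: inr hx rm.
  move=> j; rewrite in_itv/=.
  have sM := inM _ _ hx rm.
  have : (x ord0 j - y ord0 j) ^+ 2 <= M.
    apply: le_trans sM; rewrite /sqn /dot (bigD1 j)//= !mxE -expr2 lerDl.
    by apply: sumr_ge0 => i _; rewrite -expr2 sqr_ge0.
  by move=> H; apply/andP; split; nra.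
have qcont : continuous (fun p : 'rV[R]_d * R => p.2 + q p.1).
  move=> p; apply: cvgD; first exact: cvg_snd.
  apply: cvgM; first exact: cvg_cst.
  apply: (continuous_comp (f := fun p : 'rV[R]_d * R => p.1 - y) (g := @sqn R d)).
    by apply: cvgB; [exact: cvg_fst|exact: cvg_cst].
  exact: sqn_continuous.
have C0 : C (x0, fine (h x0)) by apply: inC.
have [] := compact_EVT_min (f := fun p : 'rV[R]_d * R => p.2 + q p.1) _ Ccomp.
- by exists (x0, fine (h x0)).
- exact: continuous_subspaceT.
move=> [x r] /set_mem[/= hxr _] Hmin.
exists x => x'.
have H0 := Hmin (x0, fine (h x0)) (mem_set C0).
have xfin : (prox_obj y x <= (r + q x)%:E)%E by rewrite /prox_obj EFinD leeD2r.
apply: (le_trans xfin).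
rewrite /prox_obj; case hx' : (h x') => [r'| |]; last by have := hNy x'; rewrite hx'.
- rewrite -EFinD lee_fin -/(q x').
  have [rm|rm] := leP (r' + q x') m0; last by apply: (le_trans H0); exact: ltW.
  by apply: (Hmin (x', r')); apply/mem_set/inC => //; rewrite hx'.
- by rewrite addye// leey.
Qed.

End Prox.

(** * Growth, Lipschitz and subgradient properties of the prox *)

Section ProxConvex.
Context {R : realType} {d : nat} (h : 'rV[R]_d -> \bar R) (a rho : R).
Hypotheses (a_gt0 : 0 < a) (arho : a * rho < 1).
Hypotheses (hprop : proper_fun h) (hwc : weakly_convex rho h).
Hypothesis proxP : forall y x, (prox_obj h a y (prox a h y) <= prox_obj h a y x)%E.

Lemma prox_fin y : h (prox a h y) \is a fin_num.
Proof.
have [hNy [x0 x0fin]] := hprop.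
have := proxP y x0; rewrite /prox_obj -(fineK x0fin).
by have := hNy (prox a h y); case: (h _) => //= r; rewrite addye// leye_eq.
Qed.

(** Quadratic growth at the minimiser of a strongly convex objective of modulus 1/a - rho. Testing
    minimality at l x + (1 - l) p and dividing by l gives the bound with (1 - l) C for C; the claim
    is the limit l -> 0. *)
Lemma prox_strong y x : h x \is a fin_num ->
  fine (h (prox a h y)) + (2 * a)^-1 * sqn (prox a h y - y)
    + (a^-1 - rho) / 2 * sqn (x - prox a h y)
  <= fine (h x) + (2 * a)^-1 * sqn (x - y).
Proof.
move=> hx; set p := prox a h y.
have hp : h p \is a fin_num by exact: prox_fin.
set B := (X in _ <= X); set A := (_ + (2 * a)^-1 * _); set C := (_ - rho) / 2 * _.
have C0 : 0 <= C.
  rewrite mulr_ge0 ?sqn_ge0// divr_ge0// subr_ge0.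
  by rewrite -[a^-1]mul1r ler_pdivlMr// mulrC ltW.
have key (l : R) : 0 < l < 1 -> A + (1 - l) * C <= B.
  move=> /andP[l0 l1].
  have := hwc x p; move=> /(_ l); rewrite l0 l1 => /(_ isT) /=.
  set m := (l *: x + _); rewrite -(fineK hx) -(fineK hp) -!EFinD => W.
  have hm : (h m <= (l * fine (h x) + (1 - l) * fine (h p)
                     + rho / 2 * (l * (1 - l) * sqn (x - p)))%:E)%E.
    rewrite -(@leeD2rE _ (rho / 2 * sqn m)%:E)// (le_trans W)//.
    rewrite -EFinD lee_fin /m sqnB sqnD !sqnZ !dotE.
    by rewrite le_eqVlt; apply/orP; left; apply/eqP; field.
  have := proxP y m; rewrite /prox_obj -/p -(fineK hp) -EFinD => H.
  have {H}{W} := le_trans H (leeD2r _ hm); rewrite -EFinD lee_fin.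
  have -> : sqn (m - y) = l * sqn (x - y) + (1 - l) * sqn (p - y) - l * (1 - l) * sqn (x - p).
    by rewrite /m !(sqnB, sqnD, sqnZ, dotE); ring.
  move=> H; rewrite -(ler_pM2l l0) -subr_ge0.
  move: H; rewrite -subr_ge0; congr (0 <= _).
  by rewrite /A /B /C; field; rewrite gt_eqF.
rewrite leNgt; apply/negP => BA.
have [C1|C1] := leP C 0.
  have := key (1 / 2); rewrite (_ : C = 0) in BA *; last by apply/le_anti; rewrite C1.
  by rewrite mulr0; move=> /(_ ltac:(lra)); lra.
(* Instead of a limit: this l makes l C at most half of the supposed gap A + C - B. *)
pose l := Num.min (1 / 2) ((A + C - B) / (2 * C)).
have l0 : 0 < l < 1.
  rewrite lt_min gt_min; apply/andP; split; last by apply/orP; left; lra.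
  by apply/andP; split; [lra|rewrite divr_gt0//; lra].
have := key l l0.
have : l * C <= (A + C - B) / 2.
  have -> : (A + C - B) / 2 = (A + C - B) / (2 * C) * C by field; rewrite gt_eqF.
  by rewrite ler_wpM2r// ge_min lexx orbT.
by lra.
Qed.

(** Adding the growth inequalities of the two prox points, each tested at the other, gives strong
    monotonicity; Young with weight 1 - a rho finishes. The constant is the [delta] of the
    theorem. *)
Lemma prox_lipschitz y y' :
  sqn (prox a h y - prox a h y') <= ((1 - a * rho) ^+ 2)^-1 * sqn (y - y').
Proof.
have := prox_strong y (prox_fin y'); have := prox_strong y' (prox_fin y).
set p := prox a h y; set p' := prox a h y' => H' H.
have b0 : 0 < 1 - a * rho by rewrite subr_gt0.
have : (1 - a * rho) * sqn (p - p') <= dot (p - p') (y - y').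
  have {H'}{H} := lerD H H'; rewrite (sqnBC p' p) -subr_ge0 => H.
  rewrite -subr_ge0 -(pmulr_rge0 _ (_ : 0 < a^-1)) ?invr_gt0//.
  move: H; congr (0 <= _).
  by rewrite !(sqnB, sqnD, dotE); field; rewrite gt_eqF.
have := dot_young (p - p') (y - y') b0 => Y D.
rewrite ler_pdivlMl ?exprn_gt0//.
have : (1 - a * rho) / 2 * sqn (p - p') <= (2 * (1 - a * rho))^-1 * sqn (y - y') by lra.
rewrite -(ler_pM2l (_ : 0 < 2 * (1 - a * rho))) ?mulr_gt0//.
congr (_ <= _); first by field.
by field; rewrite gt_eqF.
Qed.

(** Expanding the squares in the minimality of p gives the subgradient inequality up to an error |x
    - p|^2 / (2a), which is below eps |x - p| inside the radius 2 a eps. *)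
Lemma prox_subgrad y : subgrad h (prox a h y) (a^-1 *: (y - prox a h y)).
Proof.
split; first exact: prox_fin.
have hNy := hprop.1.
move=> eps eps0; exists (2 * a * eps); first by rewrite !mulr_gt0.
move=> x xd; set p := prox a h y.
have := proxP y x; rewrite /prox_obj -/p.
case hx : (h x) => [r| |]; last by have := hNy x; rewrite hx.
  rewrite -(fineK (prox_fin y)) -/p -!EFinD !lee_fin => H.
  have xx : (2 * a)^-1 * sqn (x - p) <= eps * nrm (x - p).
    rewrite -nrm_sqr expr2 mulrA ler_wpM2r ?sqrtr_ge0//.
    by rewrite ler_pdivrMl ?mulr_gt0// ltW.
  have -> : dot (a^-1 *: (y - p)) (x - p)
     = (2 * a)^-1 * sqn (p - y) - (2 * a)^-1 * sqn (x - y) + (2 * a)^-1 * sqn (x - p).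
    rewrite !(sqnB, sqnD, dotE) !(dotC y) /sqn !(dotC p x); field; rewrite gt_eqF//.
  by lra.
by move=> _; rewrite leey.
Qed.

End ProxConvex.

(** * Local steps *)

Section LocalSteps.
Context {R : realType} {d N : nat} (K : nat) (beta L : R).
Variables (gradf : 'I_N -> 'rV[R]_d -> 'rV[R]_d)
          (gs : 'I_N -> nat -> nat -> 'rV[R]_d -> 'rV[R]_d).
Hypotheses (K_gt0 : (0 < K)%N) (beta_gt0 : 0 < beta).
Hypothesis gradf_lip : forall i x y,
  sqn (gradf i x - gradf i y) <= L ^+ 2 * sqn (x - y).
Hypothesis beta_small : (beta * K%:R * L) ^+ 2 <= 1 / 1344.

Definition noise (i : 'I_N) (t : nat) (c z : 'rV[R]_d) (k : nat) : 'rV[R]_d :=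
  let x := local_iter beta gs i t c z k in gs i t k x - gradf i x.

Definition noise_sum i t c z k := \sum_(j < k) noise i t c z j.

(** Partial sums are kept whole because the cross terms of centred noise vanish in mean: a sum of k
    steps has second moment of order k, not k^2. The powers of [K] here and in [mean_noise]
    normalise both means to at most sigma^2 / (B K). *)
Definition drift_noise i t c z : R :=
  K%:R ^- 3 * \sum_(k < K) sqn (noise_sum i t c z k).

Definition mean_noise i t c z : R := K%:R ^- 2 * sqn (noise_sum i t c z K).

Definition mean_grad i t c z : 'rV[R]_d :=
  K%:R^-1 *: \sum_(k < K) gs i t k (local_iter beta gs i t c z k).

Let Kpos : 0 < K%:R :> R. Proof. by rewrite ltr0n. Qed.

Lemma local_iterE i t c z k : local_iter beta gs i t c z k - z
  = - beta *: \sum_(j < k) (gs i t j (local_iter beta gs i t c z j) + c).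
Proof.
elim: k => [|k IH]; first by rewrite big_ord0 scaler0 subrr.
by rewrite big_ord_recr /= [in RHS]scalerDr -IH scaleNr addrAC.
Qed.

Lemma DeltaE i t c z : Delta K beta gs i t c z = mean_grad i t c z + c.
Proof.
rewrite /Delta /mean_grad -opprB local_iterE scaleNr opprK scalerA.
have -> : (beta * K%:R)^-1 * beta = K%:R^-1 by field; rewrite !gt_eqF.
rewrite big_split/= scalerDr sumr_const card_ord; congr (_ + _).
by rewrite -[c *+ K]scaler_nat scalerA mulVf ?gt_eqF// scale1r.
Qed.

Lemma drift_noise_ge0 i t c z : 0 <= drift_noise i t c z.
Proof.
apply: mulr_ge0; first by rewrite invr_ge0 exprn_ge0// ltW.
by apply: sumr_ge0 => k _; exact: sqn_ge0.
Qed.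

Let drift i t c z := \sum_(k < K) sqn (local_iter beta gs i t c z k - z).

Let drift_ge0 i t c z : 0 <= drift i t c z.
Proof. by apply: sumr_ge0 => k _; exact: sqn_ge0. Qed.

Let grad_drift i t c z (k : nat) : (k <= K)%N ->
  sqn (\sum_(j < k) (gradf i (local_iter beta gs i t c z j) - gradf i z))
  <= K%:R * L ^+ 2 * drift i t c z.
Proof.
move=> kK; apply: (le_trans (sqn_sum_ord_le _)).
rewrite -mulrA ler_pM ?ler_nat//; first by apply: sumr_ge0 => j _; exact: sqn_ge0.
rewrite /drift (big_ord_widen _ (fun j => sqn (gradf i (local_iter beta gs i t c z j) - gradf i z)) kK).
rewrite big_mkcond/= big_distrr/=; apply: ler_sum => j _.
by case: ifP => // _; rewrite mulr_ge0 ?sqr_ge0 ?sqn_ge0.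
Qed.

(** A local displacement is -beta times a noise sum, a sum of gradient differences and k copies of
    [gradf i z + c]. The gradient differences reproduce the drift with factor 4e <= 4/1344, which is
    absorbed on the left; rounding the factors 2 and 4 up to 3 and 5 pays for it. *)
Lemma drift_le i t c z :
  L ^+ 2 * (K%:R^-1 * drift i t c z)
  <= (beta * K%:R * L) ^+ 2
     * (3 * drift_noise i t c z + 5 * sqn (gradf i z + c)).
Proof.
set D := drift i t c z; set A := sqn (gradf i z + c).
pose W := \sum_(k < K) sqn (noise_sum i t c z k).
have A0 : 0 <= A := sqn_ge0 _.
have D0 : 0 <= D := drift_ge0 i t c z.
have W0 : 0 <= W by apply: sumr_ge0 => k _; exact: sqn_ge0.
have step (k : 'I_K) : sqn (local_iter beta gs i t c z k - z)
    <= beta ^+ 2 * (2 * sqn (noise_sum i t c z k) + 4 * (K%:R * L ^+ 2 * D) + 4 * (K%:R ^+ 2 * A)).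
  rewrite local_iterE sqnZ sqrrN ler_wpM2l ?sqr_ge0//.
  have -> : \sum_(j < k) (gs i t j (local_iter beta gs i t c z j) + c)
    = noise_sum i t c z k
      + (\sum_(j < k) (gradf i (local_iter beta gs i t c z j) - gradf i z) + k%:R *: (gradf i z + c)).
    have -> : k%:R *: (gradf i z + c) = \sum_(j < k) (gradf i z + c).
      by rewrite sumr_const card_ord scaler_nat.
    rewrite -!big_split/=; apply: eq_bigr => j _.
    by rewrite /noise/= !subrKA.
  apply: (le_trans (sqnD_le2 _ _)); rewrite -addrA lerD2l.
  have := sqnD_le2 (\sum_(j < k) (gradf i (local_iter beta gs i t c z j) - gradf i z))
    (k%:R *: (gradf i z + c)).
  have := grad_drift i t c z (ltnW (ltn_ord k)).
  rewrite sqnZ -/D -/A.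
  have : k%:R ^+ 2 * A <= K%:R ^+ 2 * A.
    by rewrite ler_wpM2r// ler_pXn2r ?nnegrE ?ler0n// ler_nat ltnW.
  by lra.
have tot : D <= beta ^+ 2 * (2 * W + 4 * (K%:R ^+ 2 * L ^+ 2 * D) + 4 * (K%:R ^+ 3 * A)).
  apply: (le_trans (ler_sum _ (fun k _ => step k))).
  rewrite -big_distrr/= ler_wpM2l ?sqr_ge0//.
  rewrite !big_split/= -big_distrr/= !sumr_const card_ord -/W -[X in _ + X + _ <= _]mulr_natr -[X in _ + X <= _]mulr_natr.
  by rewrite le_eqVlt; apply/orP; left; apply/eqP; ring.
set e := (beta * K%:R * L) ^+ 2.
have -> : drift_noise i t c z = K%:R ^- 3 * W by [].
set X := L ^+ 2 * (K%:R^-1 * D); set Q := K%:R ^- 3 * W.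
have X0 : 0 <= X by rewrite mulr_ge0 ?sqr_ge0// mulr_ge0// invr_ge0 ltW.
have Q0 : 0 <= Q by rewrite mulr_ge0// invr_ge0 exprn_ge0// ltW.
have e0 : 0 <= e by exact: sqr_ge0.
have H : X <= e * (2 * Q + 4 * X + 4 * A).
  have := ler_wpM2l (_ : 0 <= L ^+ 2 * K%:R^-1) tot.
  rewrite mulr_ge0 ?sqr_ge0 ?invr_ge0 ?(ltW Kpos)// => /(_ isT).
  congr (_ <= _); first by rewrite /X mulrA.
  by rewrite /e /X /Q; field; rewrite gt_eqF.
have eX : e * X <= 1 / 1344 * X by rewrite ler_wpM2r.
have : 0 <= e * Q by rewrite mulr_ge0.
have : 0 <= e * A by rewrite mulr_ge0.
have -> : e * (3 * Q + 5 * A) = 3 * (e * Q) + 5 * (e * A) by ring.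
have E : e * (2 * Q + 4 * X + 4 * A) = 2 * (e * Q) + 4 * (e * X) + 4 * (e * A) by ring.
by rewrite E in H; lra.
Qed.

Lemma mean_grad_error i t c z :
  sqn (mean_grad i t c z - gradf i z)
  <= 2 * mean_noise i t c z
     + 2 * ((beta * K%:R * L) ^+ 2
            * (3 * drift_noise i t c z + 5 * sqn (gradf i z + c))).
Proof.
have -> : mean_grad i t c z - gradf i z = K%:R^-1 *: noise_sum i t c z K
   + K%:R^-1 *: \sum_(k < K) (gradf i (local_iter beta gs i t c z k) - gradf i z).
  have {1}-> : gradf i z = K%:R^-1 *: \sum_(k < K) gradf i z.
    by rewrite sumr_const card_ord -[gradf i z *+ K]scaler_nat scalerA mulVf ?scale1r// gt_eqF.
  rewrite -scalerBr -scalerDr -sumrB -big_split/=; congr (_ *: _).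
  by apply: eq_bigr => k _; rewrite /noise/= subrKA.
apply: (le_trans (sqnD_le2 _ _)).
rewrite !sqnZ exprVn /mean_noise lerD2l ler_pM2l//.
apply: (le_trans _ (drift_le i t c z)).
apply: (le_trans (ler_wpM2l _ (grad_drift i t c z (leqnn K)))).
  by rewrite invr_ge0 sqr_ge0.
by rewrite le_eqVlt; apply/orP; left; apply/eqP; field; rewrite gt_eqF.
Qed.

End LocalSteps.

(** * One round of FedCanon *)

(** Origin of the noise constants of the theorem: 50 = 25 * 2, and 25 * 2 * 3 / 1344 <= 1 / 8. The
    factor 25 is the total weight of U in [lyapunov_decrease]. *)
Lemma error_absorb (R : realFieldType) (u M Q A e : R) :
  e <= 1 / 1344 -> 0 <= Q -> 0 <= A ->
  u <= 2 * M + 2 * (e * (3 * Q + 5 * A)) ->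
  25 * u <= 50 * M + Q / 8 + 250 / 1344 * A.
Proof.
move=> e_le Q0 A0 H.
have : e * (3 * Q + 5 * A) <= 1 / 1344 * (3 * Q + 5 * A) by rewrite ler_wpM2r//; lra.
by move: H; move: (e * _) => w; lra.
Qed.

(** With X = D / a^2, the Lyapunov drop scaled by 8/a is at least 4 X - 9 U + E / 2, while 2 G <= 4
    X + 16 U. Hence 2 G is at most that drop plus 25 U - E / 2. Bounding 25 U returns less than E /
    2, G and Bh from its last term, so one of the two copies of G remains. *)
Lemma lyapunov_decrease (R : realFieldType) (a rho L D V U E E' p p' G g M Bh : R) :
  0 < a -> a * (rho + L) + 4 * a ^+ 2 * L ^+ 2 <= 1 / 2 ->
  0 <= D -> 0 <= E -> 0 <= Bh -> 0 <= G -> V <= U ->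
  p' <= p + a * V - a^-1 * (3 / 4 - a * (rho + L) / 2) * D ->
  E' <= 2 * (L ^+ 2 * D) + 2 * U ->
  G <= 2 * (a ^- 2 * D) + 8 * V ->
  25 * U <= M + 250 / 1344 * (E + g) ->
  g <= 2 * G + 2 * Bh ->
  G <= 8 / a * ((p + a / 16 * E) - (p' + a / 16 * E')) + M + Bh.
Proof.
move=> a0 a_small D0 E0 Bh0 G0 VU Hp HE HG HU Hg.
have a8 : 0 <= 8 / a by rewrite divr_ge0// ltW.
pose X := a ^- 2 * D.
have X0 : 0 <= X by rewrite mulr_ge0// invr_ge0 exprn_ge0// ltW.
have H1 : 8 / a * p' <= 8 / a * p + 8 * V - 8 * (3 / 4 - a * (rho + L) / 2) * X.
  rewrite (le_trans (ler_wpM2l a8 Hp))//.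
  by rewrite /X le_eqVlt; apply/orP; left; apply/eqP; field; rewrite gt_eqF.
have H2 : E' / 2 <= a ^+ 2 * L ^+ 2 * X + U.
  have -> : a ^+ 2 * L ^+ 2 * X = L ^+ 2 * D by rewrite /X; field; rewrite gt_eqF.
  by move: HE; lra.
(* Four times the step-size condition, with room to spare in the [a ^+ 2 * L ^+ 2] term. *)
have H3 : 4 * X <= (8 * (3 / 4 - a * (rho + L) / 2) - a ^+ 2 * L ^+ 2) * X.
  rewrite ler_wpM2r//.
  have : 0 <= a ^+ 2 * L ^+ 2 by rewrite mulr_ge0 ?sqr_ge0.
  by move: a_small; lra.
have -> : 8 / a * ((p + a / 16 * E) - (p' + a / 16 * E'))
  = 8 / a * p + E / 2 - 8 / a * p' - E' / 2 by field; rewrite gt_eqF.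
by move: H1 H2 H3 HG HU Hg; rewrite -/X; lra.
Qed.

Section Round.
Context {R : realType} {d N : nat} (K : nat) (alpha beta L rho Bh : R).
Variables (h : 'rV[R]_d -> \bar R) (f : 'I_N -> 'rV[R]_d -> R).
Variables (gradf : 'I_N -> 'rV[R]_d -> 'rV[R]_d)
          (gs : 'I_N -> nat -> nat -> 'rV[R]_d -> 'rV[R]_d).
Hypotheses (N_gt0 : (0 < N)%N) (K_gt0 : (0 < K)%N).
Hypotheses (alpha_gt0 : 0 < alpha) (beta_gt0 : 0 < beta) (L_gt0 : 0 < L).
Hypothesis gradf_lip : forall i x y,
  sqn (gradf i x - gradf i y) <= L ^+ 2 * sqn (x - y).
Hypothesis f_smooth : forall i x y,
  f i x - f i y - dot (gradf i y) (x - y) <= L / 2 * sqn (x - y).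
Hypothesis beta_small : (beta * K%:R * L) ^+ 2 <= 1 / 1344.
Hypothesis alpha_small : alpha * (rho + L) + 4 * alpha ^+ 2 * L ^+ 2 <= 1 / 2.
Hypotheses (hprop : proper_fun h) (hwc : weakly_convex rho h).
Hypothesis prox_min : forall y x,
  (prox_obj h alpha y (prox alpha h y) <= prox_obj h alpha y x)%E.
Hypothesis subgrad_bound : forall z v, subgrad h z v -> sqn v <= Bh.

Definition fbar z := N%:R^-1 * \sum_(i < N) f i z.
Definition gradfbar z := N%:R^-1 *: \sum_(i < N) gradf i z.

Definition avg (x : 'I_N -> R) : R := N%:R^-1 * \sum_(i < N) x i.

Definition heterogeneity (st : 'rV[R]_d * ('I_N -> 'rV[R]_d)) : R :=
  avg (fun i => sqn (gradf i st.1 + st.2 i - gradfbar st.1)).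

(* The small weight 1/16 keeps the noise entering through the heterogeneity of
   the next round within the constant 50. *)
Definition lyapunov st : R :=
  fine (h st.1) + fbar st.1 + alpha / 16 * heterogeneity st.

Definition round_noise (t : nat) (st : 'rV[R]_d * ('I_N -> 'rV[R]_d)) : R :=
  avg (fun i => 50 * mean_noise K beta gradf gs i t (st.2 i) st.1
                + drift_noise K beta gradf gs i t (st.2 i) st.1 / 8).

Lemma le_avg (x y : 'I_N -> R) : (forall i, x i <= y i) -> avg x <= avg y.
Proof.
by move=> xy; rewrite ler_pM2l ?invr_gt0 ?ltr0n//; apply: ler_sum.
Qed.

Lemma avgD (x y : 'I_N -> R) : avg (fun i => x i + y i) = avg x + avg y.
Proof. by rewrite /avg big_split/= mulrDr. Qed.

Lemma avgM a (x : 'I_N -> R) : avg (fun i => a * x i) = a * avg x.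
Proof. by rewrite /avg -big_distrr/= mulrCA. Qed.

Let Npos : 0 < N%:R :> R. Proof. by rewrite ltr0n. Qed.

Let avg_cst a : avg (fun=> a) = a.
Proof. by rewrite /avg sumr_const card_ord -[a *+ N]mulr_natl mulKf// gt_eqF. Qed.

Lemma fbar_smooth x y :
  fbar x - fbar y - dot (gradfbar y) (x - y) <= L / 2 * sqn (x - y).
Proof.
rewrite -(avg_cst (L / 2 * _)).
apply: le_trans (le_avg (fun i => f_smooth i x y)).
rewrite /gradfbar dotZl dot_suml /fbar /avg -!mulrBr !sumrB.
exact: lexx.
Qed.

Lemma gradfbar_lip x y :
  sqn (gradfbar x - gradfbar y) <= L ^+ 2 * sqn (x - y).
Proof.
rewrite /gradfbar -scalerBr -sumrB; apply: (le_trans (sqn_avg_le _ N_gt0)).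
rewrite -[leRHS]avg_cst; apply: le_avg => i; exact: gradf_lip.
Qed.

Lemma heterogeneity_ge0 st : 0 <= heterogeneity st.
Proof.
by rewrite mulr_ge0 ?invr_ge0 ?ler0n// sumr_ge0// => i _; exact: sqn_ge0.
Qed.

Let al_rho : alpha * rho <= 1 / 2.
Proof.
have : 0 <= alpha * L by rewrite mulr_ge0// ltW.
have : 0 <= 4 * alpha ^+ 2 * L ^+ 2 by rewrite mulr_ge0 ?sqr_ge0// mulr_ge0 ?sqr_ge0.
by move: alpha_small; lra.
Qed.

Let al_rho1 : alpha * rho < 1. Proof. by move: al_rho; lra. Qed.

Lemma prox_lipschitz4 y y' :
  sqn (prox alpha h y - prox alpha h y') <= 4 * sqn (y - y').
Proof.
apply: (le_trans (prox_lipschitz alpha_gt0 al_rho1 hprop hwc prox_min _ _)).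
rewrite ler_wpM2r ?sqn_ge0// -[leRHS]invrK lef_pV2 ?posrE ?exprn_gt0 ?subr_gt0//.
by move: al_rho; nra.
Qed.

(** Quadratic growth of the prox objective tested at z, plus smoothness of [fbar]. Young on the
    gradient error spends 1/(4 alpha) of the 1/alpha available, hence 3/4. *)
Lemma prox_descent (z u : 'rV[R]_d) : h z \is a fin_num ->
  let z' := prox alpha h (z - alpha *: u) in
  fine (h z') + fbar z' <= fine (h z) + fbar z + alpha * sqn (u - gradfbar z)
    - alpha^-1 * (3 / 4 - alpha * (rho + L) / 2) * sqn (z' - z).
Proof.
move=> hz; cbv zeta.
have := prox_strong alpha_gt0 al_rho1 hprop hwc prox_min (z - alpha *: u) hz.
set z' := prox alpha h _.
have h1 : sqn (z' - (z - alpha *: u))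
   = sqn (z' - z) + 2 * alpha * dot (z' - z) u + sqn (alpha *: u).
  have -> : z' - (z - alpha *: u) = (z' - z) + alpha *: u by rewrite opprB addrA addrAC.
  by rewrite (sqnD (z' - z)) dotZr mulrA.
have h2 : z - (z - alpha *: u) = alpha *: u by rewrite opprB addrC subrK.
rewrite h1 h2 (sqnBC z) => H.
have {}H : fine (h z') + dot (z' - z) u + (alpha^-1 - rho / 2) * sqn (z' - z)
    <= fine (h z).
  move: H; rewrite -subr_ge0 -[in X in _ -> X]subr_ge0; congr (0 <= _).
  by field; rewrite gt_eqF.
have := fbar_smooth z' z.
have a2 : 0 < (2 * alpha)^-1 by rewrite invr_gt0 mulr_gt0.
have := dot_young (z' - z) (gradfbar z - u) a2.
rewrite (sqnBC (gradfbar z)) (dotDr (gradfbar z)) (dotNr u) (dotC (z' - z) (gradfbar z)).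
have -> : (2 * (2 * alpha)^-1)^-1 = alpha by field; rewrite gt_eqF.
have -> : (2 * alpha)^-1 / 2 * sqn (z' - z) = alpha^-1 * sqn (z' - z) / 4.
  by field; rewrite gt_eqF.
have -> : alpha^-1 * (3 / 4 - alpha * (rho + L) / 2) * sqn (z' - z)
   = 3 / 4 * (alpha^-1 * sqn (z' - z)) - (rho + L) / 2 * sqn (z' - z).
  by field; rewrite gt_eqF.
by move: H; lra.
Qed.

(** The step actually taken uses u, the gradient mapping uses [gradfbar z]; the Lipschitz prox
    compares the two points, and 8 = 2 * 4. *)
Lemma Gmap_le (z u : 'rV[R]_d) : let z' := prox alpha h (z - alpha *: u) in
  sqn (Gmap alpha h z (gradfbar z))
  <= 2 * (alpha ^- 2 * sqn (z' - z)) + 8 * sqn (u - gradfbar z).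
Proof.
cbv zeta; set z' := prox alpha h _.
pose w := prox alpha h (z - alpha *: gradfbar z).
have zw : sqn (z' - w) <= 4 * (alpha ^+ 2 * sqn (u - gradfbar z)).
  have := prox_lipschitz4 (z - alpha *: u) (z - alpha *: gradfbar z).
  rewrite -/z' -/w -(sqnZ alpha (u - gradfbar z)).
  have -> : z - alpha *: u - (z - alpha *: gradfbar z) = - (alpha *: (u - gradfbar z)).
    by rewrite scalerBr !opprB addrC addrA subrK.
  by rewrite sqnN.
have -> : Gmap alpha h z (gradfbar z) = alpha^-1 *: (z - z') + alpha^-1 *: (z' - w).
  by rewrite -scalerDr subrKA.
apply: (le_trans (sqnD_le2 _ _)).
move: zw; clearbody z' w => zw.
have e1 := sqnZ alpha^-1 (z - z'); have e2 := sqnZ alpha^-1 (z' - w).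
rewrite e1 e2 exprVn (sqnBC z z') lerD2l.
have -> : 8 * sqn (u - gradfbar z) = 2 * (alpha ^- 2 * (4 * (alpha ^+ 2 * sqn (u - gradfbar z)))).
  by field; rewrite gt_eqF.
by rewrite ler_pM2l// ler_pM2l// invr_gt0 exprn_gt0.
Qed.

Lemma gradfbar_bound z :
  sqn (gradfbar z) <= 2 * sqn (Gmap alpha h z (gradfbar z)) + 2 * Bh.
Proof.
set p := prox alpha h (z - alpha *: gradfbar z).
have := subgrad_bound (prox_subgrad alpha_gt0 hprop prox_min (z - alpha *: gradfbar z)).
rewrite -/p; set u := (_ *: _) => Hu.
have E : gradfbar z = Gmap alpha h z (gradfbar z) - u.
  rewrite /Gmap /u -/p -scalerBr opprB addrA subrK opprB addrC subrK.
  by rewrite scalerA mulVf ?scale1r// gt_eqF.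
move: Hu; clearbody u; rewrite {1}E; clear E.
move: (Gmap _ _ _ _) => g Hu.
by apply: (le_trans (sqnD_le2 _ _)); rewrite sqnN; lra.
Qed.

Section Step.
Variables (t : nat) (z : 'rV[R]_d) (c : 'I_N -> 'rV[R]_d).
Hypotheses (sum_c0 : \sum_(i < N) c i = 0) (hz : h z \is a fin_num).

Let v i := mean_grad K beta gs i t (c i) z.
Let vbar := N%:R^-1 *: \sum_(i < N) v i.
Let st' := fedcanon_round K alpha beta h gs t (z, c).
Let z' := st'.1.
Let U := avg (fun i => sqn (v i - gradf i z)).

Let DbarE : N%:R^-1 *: \sum_(i < N) Delta K beta gs i t (c i) z = vbar.
Proof.
rewrite (eq_bigr (fun i => v i + c i)) => [|i _]; last exact: DeltaE.
by rewrite big_split/= sum_c0 addr0.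
Qed.

Let z'E : z' = prox alpha h (z - alpha *: vbar).
Proof. by rewrite /z' /st' /fedcanon_round/= DbarE. Qed.

(** The old control cancels against the one inside [Delta], so the next heterogeneity sees this
    round only through the averaged gradients v. *)
Let c'E i : st'.2 i = vbar - v i.
Proof.
have -> : st'.2 i = c i + vbar - (v i + c i) by rewrite -DbarE -DeltaE.
by rewrite [c i + _]addrC [v i + _]addrC addrKA.
Qed.

Lemma round_sum_control : \sum_(i < N) st'.2 i = 0.
Proof.
rewrite (eq_bigr (fun i => vbar - v i)) => [|i _]; last exact: c'E.
have N0 : N%:R != 0 :> R by rewrite gt_eqF.
by rewrite sumrB sumr_const card_ord -[vbar *+ N]scaler_nat scalerA (mulfV N0) scale1r subrr.
Qed.

Lemma round_fin : h z' \is a fin_num.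
Proof. by rewrite z'E; exact: prox_fin hprop prox_min _. Qed.

Let vbar_error : sqn (vbar - gradfbar z) <= U.
Proof.
by rewrite /vbar /gradfbar -scalerBr -sumrB; exact: sqn_avg_le.
Qed.

(** As the controls sum to zero, the mean of [gradf i z + c i] is [gradfbar z]. This is where the
    full gradient enters the drift. *)
Let second_moment : avg (fun i => sqn (gradf i z + c i))
  = heterogeneity (z, c) + sqn (gradfbar z).
Proof.
rewrite /avg (variance_decomp _ N_gt0) /= /heterogeneity /avg /=.
by rewrite big_split/= sum_c0 addr0.
Qed.

Let U_le : 25 * U <= round_noise t (z, c)
  + 250 / 1344 * (heterogeneity (z, c) + sqn (gradfbar z)).
Proof.
rewrite -second_moment -avgM -avgM /round_noise -avgD; apply: le_avg => i /=.
have := mean_grad_error gs K_gt0 gradf_lip beta_small i t (c i) z.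
rewrite -/(v i).
exact: error_absorb beta_small (drift_noise_ge0 _ _ _ _ _ _ _ _) (sqn_ge0 _).
Qed.

(** The next heterogeneity is the empirical variance over clients of [gradf i z' - v i], hence at
    most its second moment; inserting [gradf i z] separates server movement from gradient error. *)
Let heterogeneity_next :
  heterogeneity st' <= 2 * (L ^+ 2 * sqn (z' - z)) + 2 * U.
Proof.
have vbarE : gradfbar z' - vbar = N%:R^-1 *: \sum_(i < N) (gradf i z' - v i).
  by rewrite /gradfbar /vbar -scalerBr sumrB.
have -> : heterogeneity st'
    = avg (fun i => sqn ((gradf i z' - v i) - N%:R^-1 *: \sum_(i < N) (gradf i z' - v i))).
  rewrite -vbarE; congr (_ * _); apply: eq_bigr => i _; rewrite c'E -/z'; congr sqn.
  by rewrite opprB !addrA [in RHS](addrAC _ (- v i)).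
have := variance_decomp (fun i => gradf i z' - v i) N_gt0 => /= E.
apply: (@le_trans _ _ (avg (fun i => sqn (gradf i z' - v i)))).
  by rewrite /avg E lerDl sqn_ge0.
rewrite -(avg_cst (L ^+ 2 * _)) -avgM -avgM -avgD; apply: le_avg => i.
rewrite -(subrKA (gradf i z)); apply: (le_trans (sqnD_le2 _ _)).
by rewrite (sqnBC (gradf i z)) lerD2r ler_pM2l.
Qed.

Lemma round_descent : sqn (Gmap alpha h z (gradfbar z))
  <= 8 / alpha * (lyapunov (z, c) - lyapunov st') + round_noise t (z, c) + Bh.
Proof.
have Bh0 : 0 <= Bh.
  apply: le_trans (subgrad_bound (prox_subgrad alpha_gt0 hprop prox_min z)).
  exact: sqn_ge0.
have Hd := prox_descent vbar hz; cbv zeta in Hd; rewrite -z'E in Hd.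
have HG := Gmap_le z vbar; cbv zeta in HG; rewrite -z'E in HG.
exact: (lyapunov_decrease alpha_gt0 alpha_small (sqn_ge0 (z' - z))
  (heterogeneity_ge0 (z, c)) Bh0 (sqn_ge0 _) vbar_error Hd heterogeneity_next HG
  U_le (gradfbar_bound z)).
Qed.

End Step.

Lemma fedcanon_descent (z0 : 'rV[R]_d) (c0 : 'I_N -> 'rV[R]_d) (T : nat) :
  \sum_(i < N) c0 i = 0 -> h z0 \is a fin_num ->
  let st := fedcanon K alpha beta h gs z0 c0 in
  [/\ \sum_(i < N) (st T).2 i = 0, h (st T).1 \is a fin_num &
    \sum_(t < T) sqn (Gmap alpha h (st t).1 (gradfbar (st t).1))
    <= 8 / alpha * (lyapunov (st 0%N) - lyapunov (st T))
       + \sum_(t < T) round_noise t (st t) + T%:R * Bh].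
Proof.
move=> c00 hz0 st; elim: T => [|T [IHc IHh IH]].
  by rewrite !big_ord0 subrr mulr0 mul0r !addr0.
have E : st T = ((st T).1, (st T).2) by case: (st T).
have Es : st T.+1 = fedcanon_round K alpha beta h gs T ((st T).1, (st T).2).
  by rewrite -E.
split; first by rewrite Es; exact: round_sum_control.
  by rewrite Es; exact: round_fin.
rewrite !big_ord_recr/= Es.
have := round_descent T IHc IHh; rewrite -!E -natr1.
by lra.
Qed.

End Round.

(** * Measurability *)

Section Measurability.
Context {R : realType} {d : nat}.

Lemma rV_cvg (u : nat -> 'rV[R]_d) (x : 'rV[R]_d) :
  (forall j, u n ord0 j @[n --> \oo] --> x ord0 j) -> u n @[n --> \oo] --> x.
Proof.
move=> ux; apply/cvg_mx_entourageP => A entA.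
have : \forall n \near \oo, forall i : 'I_1, forall j : 'I_d, (x i j, u n i j) \in A.
  apply: filter_forall => i; apply: filter_forall => j.
  rewrite (ord1 i); have /cvg_entourageP/(_ A entA) := ux j.
  by rewrite near_map; apply: filterS => n; rewrite inE.
by rewrite near_map.
Qed.

Definition grid_index n (x : 'rV[R]_d) : 'rV[int]_d :=
  \row_j Num.floor (n.+1%:R * x ord0 j).

Definition grid_point n (m : 'rV[int]_d) : 'rV[R]_d :=
  \row_j ((m ord0 j)%:~R / n.+1%:R).

Lemma grid_cvg x : grid_point n (grid_index n x) @[n --> \oo] --> x.
Proof.
apply: rV_cvg => j.
apply/cvgrPdist_le => e e0.
have /cvgrPdist_le/(_ e e0) := @cvg_harmonic R.
apply: filterS => n; rewrite sub0r normrN ger0_norm ?harmonic_ge0// => ne.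
apply: (le_trans _ ne); rewrite !mxE {ne}.
have n0 : 0 < n.+1%:R :> R by [].
have /andP[fl fu] := floor_itv (n.+1%:R * x ord0 j).
rewrite intrD in fu.
set m := (Num.floor _)%:~R in fl fu *.
have -> : x ord0 j - m / n.+1%:R = (n.+1%:R * x ord0 j - m) / n.+1%:R.
  by rewrite mulrBl mulrAC divff ?mul1r// gt_eqF.
have nn : 0 <= n.+1%:R^-1 :> R by rewrite invr_ge0.
rewrite normrM (ger0_norm nn) /harmonic /= -[X in _ <= X]mul1r (ler_wpM2r nn)//.
by rewrite ger0_norm ?subr_ge0// lerBlDl; exact: ltW.
Qed.

Definition vec_measurable {dT} {T : measurableType dT} (X : T -> 'rV[R]_d) :=
  forall j, measurable_fun [set: T] (fun w => X w ord0 j).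

Lemma grid_index_measurable {dT} {T : measurableType dT} (X : T -> 'rV[R]_d) n m :
  vec_measurable X -> measurable [set w | grid_index n (X w) = m].
Proof.
move=> mX.
have -> : [set w | grid_index n (X w) = m] =
    \bigcap_(j in [set: 'I_d])
      (setT `&` (fun w => n.+1%:R * X w ord0 j) @^-1`
        `[(m ord0 j)%:~R, (m ord0 j + 1)%:~R[%classic).
  apply/seteqP; split => w /=.
    by move=> <- j _; split => //=; rewrite in_itv/= mxE floor_itv.
  move=> H; apply/rowP => j; rewrite mxE; apply/eqP; rewrite floor_eq.
  by have [_ /=] := H j I; rewrite in_itv.
apply: fin_bigcap_measurable => // j _.
have mf : measurable_fun setT (fun w => n.+1%:R * X w ord0 j).
  by apply: measurable_funM => //; exact: mX.
exact: mf.
Qed.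

(** X is rounded down to the lattice of mesh 1/(n+1). On each of its countably many cells G is a
    fixed section applied to Y, and continuity in the first argument passes to the limit. *)
Lemma caratheodory_measurable {dT dS} {T : measurableType dT} {S : measurableType dS}
    (G : 'rV[R]_d -> S -> R) (X : T -> 'rV[R]_d) (Y : T -> S) :
  (forall s, continuous (G^~ s)) -> (forall x, measurable_fun setT (G x)) ->
  vec_measurable X -> measurable_fun setT Y ->
  measurable_fun setT (fun w => G (X w) (Y w)).
Proof.
move=> cG mG mX mY.
apply: (measurable_fun_cvg
  (h := fun n w => G (grid_point n (grid_index n (X w))) (Y w))); last first.
  move=> w _.
  exact: (cvg_comp (fun n => grid_point n (grid_index n (X w))) (G^~ (Y w))
    (@grid_cvg (X w)) (cG (Y w) (X w))).
move=> n _ U mU; rewrite setTI.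
have -> : (fun w => G (grid_point n (grid_index n (X w))) (Y w)) @^-1` U
  = \bigcup_(m in [set: 'rV[int]_d])
      ([set w | grid_index n (X w) = m]
       `&` (setT `&` (fun w => G (grid_point n m) (Y w)) @^-1` U)).
  apply/seteqP; split => w /=; first by move=> Uw; exists (grid_index n (X w)).
  by move=> [m _ [/= <- [_]]].
apply: countable_bigcupT_measurable; first exact: countableP.
move=> m; apply: measurableI; first exact: grid_index_measurable.
exact: (measurableT_comp (mG (grid_point n m)) mY).
Qed.

Lemma continuous_measurable {dT} {T : measurableType dT}
    (G : 'rV[R]_d -> R) (X : T -> 'rV[R]_d) :
  continuous G -> vec_measurable X -> measurable_fun setT (fun w => G (X w)).
Proof.
move=> cG mX; exact: (caratheodory_measurable (G := fun x _ => G x) (Y := id)).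
Qed.

(* The gradient need not be continuous in [x]; it is a pointwise limit of
   difference quotients of the Caratheodory function [F]. *)
Lemma gradient_measurable {dT dS} {T : measurableType dT} {S : measurableType dS}
    (F : 'rV[R]_d -> S -> R) (gF : 'rV[R]_d -> S -> 'rV[R]_d)
    (X : T -> 'rV[R]_d) (Y : T -> S) :
  (forall s, is_gradient (F^~ s) (gF^~ s)) -> (forall x, measurable_fun setT (F x)) ->
  vec_measurable X -> measurable_fun setT Y ->
  vec_measurable (fun w => gF (X w) (Y w)).
Proof.
move=> gradF mF mX mY j.
pose e : 'rV[R]_d := delta_mx ord0 j.
have cF s : continuous (F^~ s).
  by move=> x; apply: differentiable_continuous; exact: (gradF s x).1.
apply: (measurable_fun_cvg
  (h := fun n w => (harmonic n)^-1 * (F (harmonic n *: e + X w) (Y w) - F (X w) (Y w)))).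
  move=> n; apply: measurable_funM => //; apply: measurable_funB.
    apply: (caratheodory_measurable cF mF _ mY) => i.
    have -> : (fun w => (harmonic n *: e + X w) ord0 i)
            = (fun w => (harmonic n *: e) ord0 i + X w ord0 i).
      by apply/funext => w; rewrite mxE.
    by apply: measurable_funD => //; exact: mX.
  exact: (caratheodory_measurable cF mF mX mY).
move=> w _.
have [dF dot_dF] := gradF (Y w) (X w).
have -> : gF (X w) (Y w) ord0 j = 'D_e (F^~ (Y w)) (X w).
  rewrite (deriveE _ dF) dot_dF /dot (bigD1 j)//= big1 => [|i ij].
    by rewrite /e mxE !eqxx mulr1 addr0.
  by rewrite /e mxE (negPf ij) andbF mulr0.
have /cvgr_dnbhsP := diff_derivable (v := e) dF.
move=> /(_ harmonic); apply; split; last exact: cvg_harmonic.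
by move=> n; rewrite gt_eqF// harmonic_gt0.
Qed.

Lemma lipschitz_continuous (phi : 'rV[R]_d -> 'rV[R]_d) (C : R) j :
  (forall x y, sqn (phi x - phi y) <= C * sqn (x - y)) ->
  continuous (fun x => phi x ord0 j).
Proof.
move=> lip x; apply/(@cvgrPdist_lt _ _ _ (nbhs x) (nbhs_filter x)) => e e0.
have : C * sqn (x - y) @[y --> x] --> (0 : R).
  have -> : (0 : R) = C * sqn (x - x) by rewrite subrr sqn0 mulr0.
  apply: (@cvgM _ _ (nbhs x) (nbhs_filter x)); first exact: cvg_cst.
  apply: (continuous_comp (f := fun y : 'rV[R]_d => x - y) (g := @sqn R d)).
    by apply: (@cvgB _ _ _ (nbhs x) (nbhs_filter x)); [exact: cvg_cst|exact: cvg_id].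
  exact: sqn_continuous.
move=> /(@cvgrPdist_lt _ _ _ (nbhs x) (nbhs_filter x))/(_ (e ^+ 2)); rewrite exprn_gt0// => /(_ isT).
apply: filterS => y; rewrite sub0r normrN => /(le_lt_trans (ler_norm _)).
move=> /(le_lt_trans (lip x y)) H.
rewrite -(ltr_pXn2r (n := 2)) ?nnegrE ?normr_ge0 ?ltW//.
rewrite real_normK ?num_real//; apply: le_lt_trans H.
rewrite /sqn /dot (bigD1 j)//= !mxE -expr2 lerDl.
by apply: sumr_ge0 => i _; rewrite -expr2 sqr_ge0.
Qed.

Section VecMeasurable.
Context {dT : measure_display} {T : measurableType dT}.
Implicit Types X Y : T -> 'rV[R]_d.

Lemma vec_measurable_cst x : vec_measurable (fun _ : T => x).
Proof. by move=> j; exact: measurable_cst. Qed.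

Lemma vec_measurableD X Y : vec_measurable X -> vec_measurable Y ->
  vec_measurable (fun w => X w + Y w).
Proof.
move=> mX mY j; under eq_fun do rewrite mxE.
by apply: measurable_funD; [exact: mX|exact: mY].
Qed.

Lemma vec_measurableZ a X : vec_measurable X -> vec_measurable (fun w => a *: X w).
Proof.
move=> mX j; under eq_fun do rewrite mxE.
by apply: measurable_funM => //; exact: mX.
Qed.

Lemma vec_measurableN X : vec_measurable X -> vec_measurable (fun w => - X w).
Proof.
move=> mX; have -> : (fun w => - X w) = (fun w => -1 *: X w).
  by apply/funext => w; rewrite scaleN1r.
exact: vec_measurableZ.
Qed.

Lemma vec_measurableB X Y : vec_measurable X -> vec_measurable Y ->
  vec_measurable (fun w => X w - Y w).
Proof. by move=> mX mY; apply: vec_measurableD mX (vec_measurableN mY). Qed.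

Lemma vec_measurable_sum I (r : seq I) (P : pred I) (X : I -> T -> 'rV[R]_d) :
  (forall i, P i -> vec_measurable (X i)) ->
  vec_measurable (fun w => \sum_(i <- r | P i) X i w).
Proof.
move=> mX; elim: r => [|i r IH].
  by under eq_fun do rewrite big_nil; exact: vec_measurable_cst.
under eq_fun do rewrite big_cons.
case Pi : (P i); last exact: IH.
by apply: vec_measurableD IH; exact: mX.
Qed.

Lemma vec_measurable_lipschitz (phi : 'rV[R]_d -> 'rV[R]_d) C X :
  (forall x y, sqn (phi x - phi y) <= C * sqn (x - y)) ->
  vec_measurable X -> vec_measurable (fun w => phi (X w)).
Proof.
move=> lip mX j.
exact: (continuous_measurable (lipschitz_continuous (j := j) lip)).
Qed.

Lemma sqn_measurable X : vec_measurable X -> measurable_fun setT (fun w => sqn (X w)).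
Proof. by move=> mX; exact: continuous_measurable (@sqn_continuous R d) mX. Qed.

End VecMeasurable.
End Measurability.

(** * Measurability of the iterates *)

Section AlgorithmMeasurability.
Context {R : realType} {d N : nat} (K : nat) (alpha beta : R) (h : 'rV[R]_d -> \bar R).
Context {dT : measure_display} {T : measurableType dT}.
Variable gs : T -> 'I_N -> nat -> nat -> 'rV[R]_d -> 'rV[R]_d.
Hypothesis prox_meas : forall X : T -> 'rV[R]_d,
  vec_measurable X -> vec_measurable (fun w => prox alpha h (X w)).

Definition step_measurable i t k := forall X : T -> 'rV[R]_d,
  vec_measurable X -> vec_measurable (fun w => gs w i t k (X w)).

Lemma local_iter_measurable i t k (c z : T -> 'rV[R]_d) :
  (forall j, (j < k)%N -> step_measurable i t j) ->
  vec_measurable c -> vec_measurable z ->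
  vec_measurable (fun w => local_iter beta (gs w) i t (c w) (z w) k).
Proof.
move=> + mc mz; elim: k => [//|k IH] mg /=.
have {}IH := IH (fun j jk => mg j (ltnW jk)).
apply: vec_measurableB => //; apply: vec_measurableZ; apply: vec_measurableD mc.
exact: mg.
Qed.

(** Only steps of rounds before t are assumed measurable, so the lemma also applies over a
    sigma-algebra that omits a sample of round t. *)
Lemma fedcanon_measurable (z0 : 'rV[R]_d) (c0 : 'I_N -> 'rV[R]_d) t :
  (forall i t' k, (t' < t)%N -> (k < K)%N -> step_measurable i t' k) ->
  vec_measurable (fun w => (fedcanon K alpha beta h (gs w) z0 c0 t).1) /\
  forall i, vec_measurable (fun w => (fedcanon K alpha beta h (gs w) z0 c0 t).2 i).
Proof.
elim: t => [|t IH] mg; first by split => [|i]; exact: vec_measurable_cst.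
have {IH}[mz mc] := IH (fun i t' k t't kK => mg i t' k (ltnW t't) kK).
pose st w := fedcanon K alpha beta h (gs w) z0 c0 t.
have mD i : vec_measurable (fun w => Delta K beta (gs w) i t ((st w).2 i) (st w).1).
  apply: vec_measurableZ; apply: vec_measurableB => //.
  by apply: local_iter_measurable => // j jK; exact: mg.
have mDb : vec_measurable (fun w =>
    N%:R^-1 *: \sum_(i < N) Delta K beta (gs w) i t ((st w).2 i) (st w).1).
  by apply: vec_measurableZ; exact: vec_measurable_sum.
split => [|i] /=.
  by apply: prox_meas; apply: vec_measurableB => //; exact: vec_measurableZ.
by apply: vec_measurableB => //; exact: vec_measurableD.
Qed.

End AlgorithmMeasurability.

(** * Independence *)

Section IndependentFubini.
Context {R : realType} {d0 d1 d2 : measure_display} {Om : measurableType d0}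
  {T1 : measurableType d1} {T2 : measurableType d2}
  (P : probability Om R) (Q : probability T2 R) (p : Om -> T1) (Y : Om -> T2).
Hypotheses (mp : measurable_fun setT p) (mY : measurable_fun setT Y).
Hypothesis pY_indep : forall A B, measurable A -> measurable B ->
  P (p @^-1` A `&` Y @^-1` B) = (P (p @^-1` A) * Q B)%E.

Let pairf w := (p w, Y w).
Let mpair : measurable_fun setT pairf. Proof. exact: measurable_fun_pair. Qed.

HB.instance Definition _ := isMeasurableFun.Build _ _ _ _ p mp.
HB.instance Definition _ := isMeasurableFun.Build _ _ _ _ pairf mpair.

(** The joint law of (p, Y) agrees with the product of the law of p and Q on rectangles, hence
    everywhere; Tonelli then iterates the integral. *)
Lemma integral_indep (g : T1 * T2 -> \bar R) :
  measurable_fun setT g -> (forall x, 0 <= g x)%E ->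
  (\int[P]_w g (p w, Y w) = \int[P]_w \int[Q]_y g (p w, y))%E.
Proof.
move=> mg g0.
pose P1 := distribution P (p : {mfun Om >-> T1}).
pose P2 := distribution P (pairf : {mfun Om >-> (T1 * T2)%type}).
have -> : (\int[P]_w g (p w, Y w) = \int[P2]_z g z)%E.
  by rewrite ge0_integral_distribution.
have -> : (\int[P2]_z g z = \int[(P1 \x Q)%E]_z g z)%E.
  apply: eq_measure_integral => A mA _; apply/esym.
  exact: product_measure_unique.
rewrite fubini_tonelli1//.
rewrite ge0_integral_distribution//; first exact: measurable_fun_fubini_tonelli_F.
by move=> x; apply: integral_ge0.
Qed.

End IndependentFubini.

Section FreshSample.
Context {R : realType} {dO dX : measure_display} {Om : measurableType dO}
  {Xi : measurableType dX} (P : probability Om R) {I : eqType}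
  (xi : I -> Om -> Xi) (D : I -> probability Xi R).
Hypothesis mxi : forall i, measurable_fun setT (xi i).

(* The sigma-algebra generated by the samples in [s], as a measurable space on
   the carrier of [Om], is [g_sigma_algebraType (cylinder s)]. *)
Definition cylinder (s : seq I) : set (set Om) :=
  [set E | exists2 A : I -> set Xi, (forall i, measurable (A i)) &
     E = \bigcap_(i in [set` s]) xi i @^-1` A i].

Lemma cylinder_measurable s : cylinder s `<=` measurable.
Proof.
move=> _ [A mA ->]; apply: fin_bigcap_measurable; first exact: finite_seq.
by move=> i _; rewrite -[X in measurable X]setTI; exact: mxi.
Qed.

Lemma cylinderI s : setI_closed (cylinder s).
Proof.
move=> _ _ [A mA ->] [A' mA' ->]; exists (fun i => A i `&` A' i).
  by move=> i; exact: measurableI.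
by rewrite -bigcapI.
Qed.

Lemma past_measurable s : <<s cylinder s >> `<=` measurable.
Proof. by apply: smallest_sub => //; [exact: sigma_algebra_measurable|exact: cylinder_measurable]. Qed.

(** As a random variable the past is the identity of Omega into the coarser structure; it is the p
    given to [integral_indep]. *)
Lemma past_id_measurable s :
  measurable_fun setT (fun w : Om => (w : g_sigma_algebraType (cylinder s))).
Proof. by move=> _ A mA; rewrite setTI preimage_id; exact: past_measurable mA. Qed.

Lemma past_sample_measurable s i : i \in s ->
  measurable_fun setT (fun w : g_sigma_algebraType (cylinder s) => xi i w).
Proof.
move=> si _ B mB; rewrite setTI; apply: sub_sigma_algebra.
exists (fun i' => if i' == i then B else setT).
  by move=> i'; case: ifP.
apply/seteqP; split => w /=; first by move=> Bw i' _ /=; case: eqP => // ->.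
by move=> /(_ i si) /=; rewrite eqxx.
Qed.

(** Both sides are finite measures in A. They agree on cylinders, which form a pi-system, because a
    constraint on the new index j turns a cylinder over s into one over [j :: s]. *)
Lemma fresh_indep s j A B :
  (forall A, (forall i, measurable (A i)) ->
     P (\bigcap_(i in [set` s]) xi i @^-1` A i) = (\prod_(i <- s) D i (A i))%E) ->
  (forall A, (forall i, measurable (A i)) ->
     P (\bigcap_(i in [set` j :: s]) xi i @^-1` A i)
     = (\prod_(i <- j :: s) D i (A i))%E) ->
  j \notin s -> <<s cylinder s >> A -> measurable B ->
  P (A `&` xi j @^-1` B) = (P A * D j B)%E.
Proof.
move=> Ps Pjs js sA mB.
have mxB : measurable (xi j @^-1` B).
  by rewrite -[X in measurable X]setTI; exact: mxi.
have DB : (D j B = (fine (D j B))%:E)%E by rewrite fineK// fin_num_measure.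
have DB0 : 0 <= fine (D j B) by rewrite fine_ge0.
pose m1 := mrestr P mxB.
pose m2 := mscale (NngNum DB0) P.
have m1E X : m1 X = P (X `&` xi j @^-1` B) by [].
have m2E X : m2 X = (D j B * P X)%E by rewrite DB.
suff : m1 A = m2 A by rewrite m1E m2E muleC.
apply: (@g_sigma_algebra_measure_unique _ _ _ (cylinder s) _ (fun _ => setT)) => //.
- exact: cylinder_measurable.
- move=> _; exists (fun=> setT) => //.
  by apply/seteqP; split.
- by rewrite bigcup_const//; exists 0%N.
- exact: cylinderI.
- move=> _ [C mC ->]; apply: (etrans (m1E _)); apply: (etrans _ (esym (m2E _))).
  rewrite Ps//.
  pose C' i := if i == j then B else C i.
  have -> : \bigcap_(i in [set` s]) xi i @^-1` C i `&` xi j @^-1` B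
      = \bigcap_(i in [set` j :: s]) xi i @^-1` C' i.
    apply/seteqP; split => w /=.
      move=> [H Bw] i /=; rewrite inE /C'; case: eqP => [->//|_ /= si].
      exact: H.
    move=> H; split => [i /= si|]; last first.
      by have := H j; rewrite /= mem_head /C' eqxx; apply.
    have := H i; rewrite /= inE si orbT => /(_ isT); rewrite /C'.
    by case: eqP => // ij; rewrite -ij si in js.
  rewrite Pjs; last by move=> i; rewrite /C'; case: ifP.
  rewrite big_cons {1}/C' eqxx; congr (_ * _)%E.
  apply: eq_big_seq => i si; rewrite /C'; case: eqP => // ij.
  by rewrite -ij si in js.
- move=> k; apply: (le_lt_trans _ (ltry 1)).
  by apply: (@le_trans _ _ (P (xi j @^-1` B))); [rewrite -[X in (_ <= P X)%E]setTI|exact: probability_le1].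
Qed.

End FreshSample.

(** * Fresh samples *)

Section SecondMoment.
Context {R : realType} {d : nat} {dX : measure_display} {Xi : measurableType dX}.
Variables (Q : probability Xi R) (v : Xi -> 'rV[R]_d) (m : 'rV[R]_d) (s2 : R).
Hypothesis v_mean : forall j, Q.-integrable setT (fun s => (v s ord0 j)%:E) /\
  (\int[Q]_s (v s ord0 j)%:E = (m ord0 j)%:E)%E.
Hypothesis v_var : (\int[Q]_s (sqn (v s - m))%:E <= s2%:E)%E.

Let v_measurable : vec_measurable v.
Proof.
move=> j; apply/measurable_EFinP.
exact: (measurable_int _ (v_mean j).1).
Qed.

Let centered j : Q.-integrable setT (fun s => ((v s - m) ord0 j)%:E) /\
  (\int[Q]_s ((v s - m) ord0 j)%:E = 0)%E.
Proof.
have [iv ev] := v_mean j.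
have ic : Q.-integrable setT (fun _ => (- m ord0 j)%:E).
  by apply: finite_measure_integrable_cst.
have E s : ((v s - m) ord0 j)%:E = ((v s ord0 j)%:E + (- m ord0 j)%:E)%E.
  by rewrite !mxE EFinD.
under [X in integrable _ _ X]eq_fun do rewrite E.
under eq_integral do rewrite E.
split; first exact: integrableD.
by rewrite integralD// ev integral_cst//= probability_setT mule1 -EFinD subrr.
Qed.

Let linear_part (u : 'rV[R]_d) (r : seq 'I_d) :
  let l s := \sum_(j <- r) u ord0 j * (v s - m) ord0 j in
  Q.-integrable setT (EFin \o l) /\ (\int[Q]_s (l s)%:E = 0)%E.
Proof.
elim: r => [|j r [IHi IHe]] /=.
  split.
    by apply: (eq_integrable _ _ _ _ (integrable0 _ _)) => // s _ /=; rewrite big_nil.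
  by under eq_integral do rewrite big_nil; rewrite integral0.
have [ij ej] := centered j.
have E s : (\sum_(k <- j :: r) u ord0 k * (v s - m) ord0 k)%:E
   = ((u ord0 j)%:E * ((v s - m) ord0 j)%:E
      + (\sum_(k <- r) u ord0 k * (v s - m) ord0 k)%:E)%E.
  by rewrite big_cons EFinD EFinM.
have iu : Q.-integrable setT (fun s => (u ord0 j)%:E * ((v s - m) ord0 j)%:E)%E.
  exact: integrableZl.
split.
  apply: (eq_integrable _ _ _ _ (integrableD _ iu IHi)) => // s _.
  by rewrite /= E.
under eq_integral do rewrite E.
by rewrite integralD// integralZl// ej mule0 add0e.
Qed.

Lemma second_moment_shift u :
  (\int[Q]_s (sqn (u + (v s - m)))%:E <= (sqn u + s2)%:E)%E.
Proof.
have [il el] := linear_part (2 *: u) (index_enum 'I_d).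
have mw : vec_measurable (fun s => v s - m).
  by apply: vec_measurableB => //; exact: vec_measurable_cst.
have msq : measurable_fun setT (fun s => (sqn (v s - m))%:E).
  by apply/measurable_EFinP; exact: sqn_measurable.
have isq : Q.-integrable setT (fun s => (sqn (v s - m))%:E).
  apply/integrableP; split => //.
  under eq_integral do rewrite gee0_abs ?lee_fin ?sqn_ge0//.
  by apply: (le_lt_trans v_var); rewrite ltry.
have E s : (sqn (u + (v s - m)))%:E =
    ((sqn u)%:E + ((dot (2 *: u) (v s - m))%:E + (sqn (v s - m))%:E))%E.
  by rewrite sqnD dotZl -!EFinD addrA.
under eq_integral do rewrite E.
have ic : Q.-integrable setT (fun _ => (sqn u)%:E).
  by apply: finite_measure_integrable_cst.
rewrite integralD//; last exact: integrableD.
rewrite integralD// [X in (_ + (X + _))%E](_ : _ = 0)%E; last exact: el.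
rewrite integral_cst//= probability_setT mule1 add0e EFinD.
exact: leeD2l.
Qed.

End SecondMoment.

Section FreshStep.
Context {R : realType} {d : nat} {dO dX : measure_display} {Om : measurableType dO}
  {Xi : measurableType dX} (P : probability Om R) {I : eqType}
  (xi : I -> Om -> Xi) (D : I -> probability Xi R).
Hypothesis mxi : forall i, measurable_fun setT (xi i).
Variables (s : seq I) (j : I).
Hypothesis indep : forall r A, uniq r -> {subset r <= j :: s} ->
  (forall i, measurable (A i)) ->
  P (\bigcap_(i in [set` r]) xi i @^-1` A i) = (\prod_(i <- r) D i (A i))%E.
Hypotheses (us : uniq s) (js : j \notin s).

Local Notation past := (g_sigma_algebraType (cylinder xi s)).

Variables (F : 'rV[R]_d -> Xi -> R) (gF : 'rV[R]_d -> Xi -> 'rV[R]_d)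
  (g : 'rV[R]_d -> 'rV[R]_d) (s2 : R).
Hypothesis gradF : forall y, is_gradient (F^~ y) (gF^~ y).
Hypothesis mF : forall x, measurable_fun setT (F x).
Hypothesis gF_mean : forall x k,
  (D j).-integrable setT (fun y => (gF x y ord0 k)%:E) /\
  (\int[D j]_y (gF x y ord0 k)%:E = (g x ord0 k)%:E)%E.
Hypothesis gF_var : forall x, (\int[D j]_y (sqn (gF x y - g x))%:E <= s2%:E)%E.

(** Everything is nonnegative, so u may have infinite second moment and no integrability has to be
    carried through the inductions. *)
Lemma fresh_step (u X : past -> 'rV[R]_d) :
  vec_measurable u -> vec_measurable X -> vec_measurable (fun w => g (X w)) ->
  (\int[P]_w (sqn (u w + (gF (X w) (xi j w) - g (X w))))%:E
   <= \int[P]_w (sqn (u w))%:E + s2%:E)%E.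
Proof.
move=> mu mX mgX.
pose G (z : past * Xi) := (sqn (u z.1 + (gF (X z.1) z.2 - g (X z.1))))%:E.
have mfst (Y : past -> 'rV[R]_d) : vec_measurable Y ->
    vec_measurable (fun z : past * Xi => Y z.1).
  by move=> mY k; apply: measurableT_comp (mY k) _; exact: measurable_fst.
have mG : measurable_fun setT G.
  apply/measurable_EFinP; apply: sqn_measurable.
  apply: vec_measurableD; first exact: mfst.
  apply: vec_measurableB; last exact: (mfst (fun w => g (X w))).
  by apply: (gradient_measurable gradF mF); [exact: mfst|exact: measurable_snd].
have G0 z : (0 <= G z)%E by rewrite lee_fin sqn_ge0.
have mid := past_id_measurable mxi (s := s).
have ind (A : set past) B : measurable A -> measurable B ->
    P ((fun w : Om => (w : past)) @^-1` A `&` xi j @^-1` B)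
    = (P ((fun w : Om => (w : past)) @^-1` A) * D j B)%E.
  move=> mA mB; apply: (fresh_indep mxi (s := s)) => //.
  - move=> C mC; apply: indep => // i si; by rewrite inE si orbT.
  - by move=> C mC; apply: indep => //=; rewrite js.
have := integral_indep mid (mxi j) ind mG G0.
rewrite /G /= => ->.
have mu' : measurable_fun setT (fun w : Om => (sqn (u w))%:E).
  apply/measurable_EFinP.
  exact: (measurableT_comp (sqn_measurable mu) mid).
have mH := measurableT_comp (measurable_fun_fubini_tonelli_F (m2 := D j) G mG G0) mid.
have s20 : 0 <= s2.
  by rewrite -lee_fin; apply: le_trans (gF_var 0); apply: integral_ge0 => y _; rewrite lee_fin sqn_ge0.
apply: (@le_trans _ _ (\int[P]_w ((sqn (u w))%:E + s2%:E))%E).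
  apply: ge0_le_integral => //.
  - by move=> w _; apply: integral_ge0 => y _; rewrite lee_fin sqn_ge0.
  - exact: emeasurable_funD.
  - by move=> w _; rewrite -EFinD; exact: second_moment_shift.
rewrite ge0_integralD//; last by move=> w _; rewrite lee_fin sqn_ge0.
by rewrite integral_cst//= probability_setT mule1.
Qed.

End FreshStep.

(** * Mean of the gradient noise *)

Section MeanBound.
Context {R : realType} {dO : measure_display} {Om : measurableType dO}
  (P : probability Om R).

(* Nonnegativity and measurability are bundled so that the bound is stable
   under sums without any integrability side condition. *)
Definition mean_le (X : Om -> R) (c : R) : Prop :=
  [/\ measurable_fun setT X, forall w, 0 <= X w & (\int[P]_w (X w)%:E <= c%:E)%E].

Lemma mean_le_trans X c c' : mean_le X c -> c <= c' -> mean_le X c'.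
Proof.
by move=> [mX X0 Xc] cc'; split => //; apply: (le_trans Xc); rewrite lee_fin.
Qed.

Lemma mean_le_cst c : 0 <= c -> mean_le (fun=> c) c.
Proof.
by move=> c0; split => //; rewrite integral_cst//= probability_setT mule1.
Qed.

Lemma mean_leD X Y c c' : mean_le X c -> mean_le Y c' ->
  mean_le (fun w => X w + Y w) (c + c').
Proof.
move=> [mX X0 Xc] [mY Y0 Yc]; split.
- exact: measurable_funD.
- by move=> w; rewrite addr_ge0.
- under eq_integral do rewrite EFinD.
  rewrite ge0_integralD//; first by rewrite EFinD leeD.
  + by move=> w _; rewrite lee_fin.
  + exact/measurable_EFinP.
  + by move=> w _; rewrite lee_fin.
  + exact/measurable_EFinP.
Qed.

Lemma mean_leZ a X c : 0 <= a -> mean_le X c -> mean_le (fun w => a * X w) (a * c).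
Proof.
move=> a0 [mX X0 Xc]; split.
- exact: measurable_funM.
- by move=> w; rewrite mulr_ge0.
- under eq_integral do rewrite EFinM.
  rewrite ge0_integralZl_EFin//; first by rewrite EFinM lee_wpmul2l ?lee_fin.
  + by move=> w _; rewrite lee_fin.
  + exact/measurable_EFinP.
Qed.

Lemma mean_le_sum (I : Type) (r : seq I) (X : I -> Om -> R) (c : I -> R) :
  (forall i, mean_le (X i) (c i)) ->
  mean_le (fun w => \sum_(i <- r) X i w) (\sum_(i <- r) c i).
Proof.
move=> H; elim: r => [|i r IH].
  have -> : (fun w => \sum_(i <- [::]) X i w) = (fun=> 0).
    by apply/funext => w; rewrite big_nil.
  by rewrite big_nil; exact: mean_le_cst.
have -> : (fun w => \sum_(k <- i :: r) X k w) = (fun w => X i w + \sum_(k <- r) X k w).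
  by apply/funext => w; rewrite big_cons.
by rewrite big_cons; exact: mean_leD.
Qed.

End MeanBound.

Section NoiseMeasurability.
Context {R : realType} {d N B : nat} (beta C : R).
Context {dT dX : measure_display} {T : measurableType dT} {Xi : measurableType dX}.
Variables (F : 'I_N -> 'rV[R]_d -> Xi -> R) (gF : 'I_N -> 'rV[R]_d -> Xi -> 'rV[R]_d)
  (gradf : 'I_N -> 'rV[R]_d -> 'rV[R]_d).
Variable xi : 'I_N -> nat -> nat -> 'I_B -> T -> Xi.
Hypothesis gradF : forall i y, is_gradient (fun x => F i x y) (fun x => gF i x y).
Hypothesis mF : forall i x, measurable_fun setT (F i x).
Hypothesis gradf_lip : forall i x y,
  sqn (gradf i x - gradf i y) <= C * sqn (x - y).

Local Notation gs := (minibatch_grad gF xi).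

Lemma minibatch_measurable i t k : (forall b, measurable_fun setT (xi i t k b)) ->
  step_measurable gs i t k.
Proof.
move=> mxi X mX; apply: vec_measurableZ; apply: vec_measurable_sum => b _.
exact: (gradient_measurable (gradF i) (mF i)).
Qed.

Lemma noise_measurable i t k (c z : T -> 'rV[R]_d) :
  (forall j b, (j <= k)%N -> measurable_fun setT (xi i t j b)) ->
  vec_measurable c -> vec_measurable z ->
  vec_measurable (fun w => noise beta gradf (gs w) i t (c w) (z w) k).
Proof.
move=> mxi mc mz.
have mx : vec_measurable (fun w => local_iter beta (gs w) i t (c w) (z w) k).
  apply: local_iter_measurable => // j jk; apply: minibatch_measurable => b.
  by apply: mxi; exact: ltnW.
apply: vec_measurableB; last exact: (vec_measurable_lipschitz (gradf_lip i)).
by apply: minibatch_measurable mx => b; exact: mxi.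
Qed.

Lemma noise_sum_measurable i t k (c z : T -> 'rV[R]_d) :
  (forall j b, (j < k)%N -> measurable_fun setT (xi i t j b)) ->
  vec_measurable c -> vec_measurable z ->
  vec_measurable (fun w => noise_sum beta gradf (gs w) i t (c w) (z w) k).
Proof.
move=> mxi mc mz; apply: vec_measurable_sum => j _.
apply: noise_measurable => // j' b j'j; apply: mxi.
exact: leq_ltn_trans j'j (ltn_ord j).
Qed.

End NoiseMeasurability.

(** Splitting the mini-batch noise into single-sample noises at one common point lets the samples be
    added one by one. *)
Lemma noiseE (R : realType) (d N B : nat) (dO : measure_display)
  (Om : measurableType dO) (Xi : Type) (beta : R)
  (gF : 'I_N -> 'rV[R]_d -> Xi -> 'rV[R]_d) (gradf : 'I_N -> 'rV[R]_d -> 'rV[R]_d)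
  (xi : 'I_N -> nat -> nat -> 'I_B -> Om -> Xi) (w : Om) i t c z k :
  (0 < B)%N ->
  let x := local_iter beta (minibatch_grad gF xi w) i t c z k in
  noise beta gradf (minibatch_grad gF xi w) i t c z k
  = B%:R^-1 *: \sum_(b < B) (gF i x (xi i t k b w) - gradf i x).
Proof.
move=> B0 /=; rewrite /noise {1}/minibatch_grad sumrB scalerBr; congr (_ - _).
rewrite sumr_const card_ord -[gradf _ _ *+ B]scaler_nat scalerA mulVf ?scale1r//.
by rewrite pnatr_eq0 -lt0n.
Qed.

Section NoiseMean.
Context {R : realType} {d N B : nat} (K : nat) (alpha beta C : R) (h : 'rV[R]_d -> \bar R).
Context {dO dX : measure_display} {Om : measurableType dO} {Xi : measurableType dX}.
Variables (P : probability Om R) (D : 'I_N -> probability Xi R).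
Variables (F : 'I_N -> 'rV[R]_d -> Xi -> R) (gF : 'I_N -> 'rV[R]_d -> Xi -> 'rV[R]_d)
  (gradf : 'I_N -> 'rV[R]_d -> 'rV[R]_d).
Variable xi : 'I_N -> nat -> nat -> 'I_B -> Om -> Xi.
Variable s2 : R.
Hypothesis B_gt0 : (0 < B)%N.
Hypothesis gradF : forall i y, is_gradient (fun x => F i x y) (fun x => gF i x y).
Hypothesis mF : forall i x, measurable_fun setT (F i x).
Hypothesis gradf_lip : forall i x y,
  sqn (gradf i x - gradf i y) <= C * sqn (x - y).
Hypothesis prox_lip : forall x y,
  sqn (prox alpha h x - prox alpha h y) <= 4 * sqn (x - y).
Hypothesis iid : iid_samples K P D xi.
Hypothesis gF_mean : forall i x k,
  (D i).-integrable setT (fun y => (gF i x y ord0 k)%:E) /\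
  (\int[D i]_y (gF i x y ord0 k)%:E = (gradf i x ord0 k)%:E)%E.
Hypothesis gF_var : forall i x,
  (\int[D i]_y (sqn (gF i x y - gradf i x))%:E <= s2%:E)%E.
Variables (z0 : 'rV[R]_d) (c0 : 'I_N -> 'rV[R]_d).

Let idx : eqType := ('I_N * nat * nat * 'I_B)%type.
Let xi' (j : idx) := xi j.1.1.1 j.1.1.2 j.1.2 j.2.
Let D' (j : idx) := D j.1.1.1.

(** Rounds 0 to t inclusive, but only k < K, the range in which [iid_samples] gives independence;
    [undup] supplies the uniqueness it asks for. *)
Let all_idx (t : nat) : seq idx :=
  undup [seq (p, b) | p <- [seq (q, k) |
      q <- [seq (i, t') | i <- enum 'I_N, t' <- iota 0 t.+1], k <- iota 0 K],
    b <- enum 'I_B].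

Let mem_all_idx t i t' k b :
  ((i, t', k, b) \in all_idx t) = (t' <= t)%N && (k < K)%N.
Proof.
rewrite mem_undup; apply/allpairsP/idP.
  move=> [[p b'] [H1 _ [ep _]]].
  case/allpairsP: H1 => -[q k'] [H2 hk ep'].
  case/allpairsP: H2 => -[i' t''] [_ ht eq].
  move: ep; rewrite [p]ep' [q]eq => -[_ -> ->].
  by move: ht hk; rewrite !mem_iota !add0n ltnS /= => -> ->.
move=> /andP[ht hk]; exists ((i, t', k), b); split => //; last by rewrite mem_enum.
apply/allpairsP; exists ((i, t'), k); split => //; last by rewrite mem_iota.
by apply/allpairsP; exists (i, t'); split => //; rewrite ?mem_enum ?mem_iota.
Qed.

(** Draws later than j are kept too: they are independent of j as well, and everything determined
    before j stays measurable. *)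
Let others t j : seq idx := [seq x <- all_idx t | x != j].

Let gs := minibatch_grad gF xi.
Let st t w := fedcanon K alpha beta h (gs w) z0 c0 t.
Let S i t k w := noise_sum beta gradf (gs w) i t ((st t w).2 i) (st t w).1 k.
Let X i t k w := local_iter beta (gs w) i t ((st t w).2 i) (st t w).1 k.
Let single i t k b w := gF i (X i t k w) (xi i t k b w) - gradf i (X i t k w).

Section OneSample.
Variables (i : 'I_N) (t k : nat) (b : 'I_B).
Hypothesis kK : (k < K)%N.

Local Notation past := (g_sigma_algebraType (cylinder xi' (others t (i, t, k, b)))).

Let mxi_past i' t' k' b' : (t' <= t)%N -> (k' < K)%N ->
  (i', t', k', b') != (i, t, k, b) ->
  measurable_fun setT (fun w : past => xi i' t' k' b' w).
Proof.
move=> t't k'K ne.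
apply: (@past_sample_measurable _ _ _ _ _ xi' (others t (i, t, k, b)) (i', t', k', b')).
by rewrite mem_filter ne mem_all_idx t't k'K.
Qed.

(** The same samples, retyped on the coarser space so that the measurability lemmas can be
    instantiated there. *)
Let xi_past i' t' k' b' : past -> Xi := xi i' t' k' b'.

Let mstate : vec_measurable (fun w : past => (st t w).1) /\
  forall i', vec_measurable (fun w : past => (st t w).2 i').
Proof.
apply: (@fedcanon_measurable _ _ _ _ _ _ _ _ past (minibatch_grad gF xi_past)).
  by move=> Y mY; exact: (vec_measurable_lipschitz prox_lip).
move=> i' t' k' t't k'K; apply: (minibatch_measurable gradF mF) => b'.
apply: mxi_past => //; first exact: ltnW.
by apply/eqP => -[_ e _ _]; rewrite e ltnn in t't.
Qed.

Let ne_step k' b' : (k' < k)%N -> (i, t, k', b') != (i, t, k, b).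
Proof. by move=> k'k; apply/eqP => -[e _]; rewrite e ltnn in k'k. Qed.

Let mX : vec_measurable (fun w : past => X i t k w).
Proof.
apply: (@local_iter_measurable _ _ _ _ _ past (minibatch_grad gF xi_past)).
- move=> k' k'k; apply: (minibatch_measurable gradF mF) => b'.
  by apply: mxi_past => //; [exact: ltn_trans kK|exact: ne_step].
- exact: mstate.2.
- exact: mstate.1.
Qed.

Let mS : vec_measurable (fun w : past => S i t k w).
Proof.
apply: (@noise_sum_measurable _ _ _ _ _ _ _ _ past _ F gF gradf xi_past) => //.
- move=> k' b' k'k.
  by apply: mxi_past => //; [exact: ltn_trans kK|exact: ne_step].
- exact: mstate.2.
- exact: mstate.1.
Qed.

Let msingle b' : b' != b -> vec_measurable (fun w : past => single i t k b' w).
Proof.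
move=> b'b; apply: vec_measurableB; last exact: (vec_measurable_lipschitz (gradf_lip i)).
apply: (gradient_measurable (gradF i) (mF i)) => //.
by apply: mxi_past => //; apply/eqP => -[e]; rewrite e eqxx in b'b.
Qed.

Lemma sample_step (r : seq 'I_B) : b \notin r ->
  (\int[P]_w (sqn ((B%:R *: S i t k w + \sum_(b' <- r) single i t k b' w) + single i t k b w))%:E
   <= \int[P]_w (sqn (B%:R *: S i t k w + \sum_(b' <- r) single i t k b' w))%:E + s2%:E)%E.
Proof.
move=> br.
apply: (@fresh_step _ _ _ _ _ _ P idx xi' D' _ (others t (i, t, k, b)) (i, t, k, b)
  _ _ _ (F i) (gF i) (gradf i) s2 _ _ _ _
  (fun w => B%:R *: S i t k w + \sum_(b' <- r) single i t k b' w) (X i t k)) => //.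
- by move=> j; exact: iid.1.
- move=> s A us sj mA; apply: iid.2 => // -[[[i' t'] k'] b'] /sj /=.
  rewrite inE => /orP[/eqP[_ _ -> _]//|].
  by rewrite mem_filter mem_all_idx => /and3P[].
- exact/filter_uniq/undup_uniq.
- by rewrite mem_filter eqxx.
- exact: gF_mean.
- exact: gF_var.
- apply: vec_measurableD; first exact: vec_measurableZ.
  have -> : r = [seq b' <- r | b' != b].
    by apply/esym/all_filterP/allP => b' b'r; apply: contraNneq br => <-.
  under eq_fun do rewrite big_filter.
  by apply: vec_measurable_sum => b'; exact: msingle.
- exact: (vec_measurable_lipschitz (gradf_lip i)).
Qed.

End OneSample.

Let batch_step i t k (r : seq 'I_B) : (k < K)%N -> uniq r ->
  (\int[P]_w (sqn (B%:R *: S i t k w + \sum_(b <- r) single i t k b w))%:E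
   <= \int[P]_w (sqn (B%:R *: S i t k w))%:E + ((size r)%:R * s2)%:E)%E.
Proof.
move=> kK; elim: r => [_|b r IH /= /andP[br ur]].
  by under eq_integral do rewrite big_nil addr0; rewrite mul0r adde0.
under eq_integral do rewrite big_cons addrCA addrC.
apply: (le_trans (sample_step i t kK br)).
by rewrite -natr1 mulrDl mul1r EFinD addeA leeD2r// IH.
Qed.

Let s2_ge0 (i : 'I_N) : 0 <= s2.
Proof.
rewrite -lee_fin; apply: le_trans (gF_var i 0).
by apply: integral_ge0 => y _; rewrite lee_fin sqn_ge0.
Qed.

(** Scaling by B turns batch averages into plain sums of k B samples, each adding at most [s2];
    dividing by B^2 later leaves k s2 / B. *)
Let noise_sum_second_moment i t k : (k <= K)%N ->
  (\int[P]_w (sqn (B%:R *: S i t k w))%:E <= ((k * B)%:R * s2)%:E)%E.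
Proof.
elim: k => [_|k IH kK].
  under eq_integral do rewrite /S /noise_sum big_ord0 scaler0 sqn0.
  by rewrite integral0 mul0n mul0r.
have E w : B%:R *: S i t k.+1 w
    = B%:R *: S i t k w + \sum_(b <- index_enum 'I_B) single i t k b w.
  rewrite /S /noise_sum big_ord_recr/= scalerDr noiseE// scalerA mulfV ?scale1r//.
  by rewrite pnatr_eq0 -lt0n.
under eq_integral do rewrite E.
apply: (le_trans (batch_step _ _ kK (index_enum_uniq _))).
rewrite -[index_enum _]enumT size_enum_ord mulSn addnC natrD mulrDl EFinD.
by rewrite leeD2r// IH// ltnW.
Qed.

Let mxi i t k b : measurable_fun setT (xi i t k b). Proof. exact: iid.1. Qed.

Lemma fedcanon_state_measurable t : vec_measurable (fun w => (st t w).1) /\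
  forall i, vec_measurable (fun w => (st t w).2 i).
Proof.
apply: fedcanon_measurable => [Y mY|i t' k _ _].
  exact: (vec_measurable_lipschitz prox_lip).
exact: (minibatch_measurable gradF mF).
Qed.

Lemma noise_sum_mean_le i t k : (k <= K)%N ->
  mean_le P (fun w => sqn (S i t k w)) (k%:R * s2 / B%:R).
Proof.
move=> kK; have B0 : B%:R != 0 :> R by rewrite pnatr_eq0 -lt0n.
have mS : vec_measurable (fun w => S i t k w).
  have [mz mc] := fedcanon_state_measurable t.
  exact: (noise_sum_measurable beta gradF mF gradf_lip).
have E w : sqn (S i t k w) = B%:R ^- 2 * sqn (B%:R *: S i t k w).
  by rewrite sqnZ mulrA mulVf ?mul1r// expf_neq0.
have -> : (fun w => sqn (S i t k w)) = (fun w => B%:R ^- 2 * sqn (B%:R *: S i t k w)).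
  exact/funext.
have -> : k%:R * s2 / B%:R = B%:R ^- 2 * ((k * B)%:R * s2).
  by rewrite natrM; field.
apply: mean_leZ; first by rewrite invr_ge0 exprn_ge0.
split; first exact: sqn_measurable (vec_measurableZ _ mS).
  by move=> w; exact: sqn_ge0.
exact: noise_sum_second_moment.
Qed.

Lemma round_noise_mean_le t : (0 < N)%N -> (0 < K)%N ->
  mean_le P (fun w => round_noise K beta gradf (gs w) t (st t w))
    (50 * (s2 / (B%:R * K%:R)) + s2 / (8 * B%:R)).
Proof.
move=> N0 K0; have i0 : 'I_N := Ordinal N0.
have Kp : 0 < K%:R :> R by rewrite ltr0n.
have Bp : 0 < B%:R :> R by rewrite ltr0n.
have Np : 0 < N%:R :> R by rewrite ltr0n.
have sp := s2_ge0 i0.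
set c := 50 * _ + _.
have -> : c = N%:R^-1 * \sum_(i < N) c.
  by rewrite sumr_const card_ord -[c *+ N]mulr_natl mulKf// gt_eqF.
apply: mean_leZ; first by rewrite invr_ge0 ltW.
apply: mean_le_sum => i; apply: mean_leD.
  apply: mean_leZ => //.
  apply: (mean_le_trans (c := K%:R ^- 2 * (K%:R * s2 / B%:R))).
    apply: mean_leZ; first by rewrite invr_ge0 exprn_ge0// ltW.
    exact: noise_sum_mean_le.
  by rewrite le_eqVlt; apply/orP; left; apply/eqP; field; rewrite !gt_eqF.
have -> : (fun w => drift_noise K beta gradf (gs w) i t ((st t w).2 i) (st t w).1 / 8)
  = (fun w => K%:R ^- 3 / 8 * \sum_(k < K) sqn (S i t k w)).
  by apply/funext => w; rewrite mulrAC.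
apply: (mean_le_trans (c := K%:R ^- 3 / 8 * \sum_(k < K) (K%:R * s2 / B%:R))).
  apply: mean_leZ; first by rewrite divr_ge0// invr_ge0 exprn_ge0// ltW.
  apply: mean_le_sum => k; apply: (mean_le_trans (noise_sum_mean_le i t (ltnW (ltn_ord k)))).
  by rewrite ler_pM2r ?invr_gt0// ler_wpM2r// ler_nat ltnW.
rewrite sumr_const card_ord -[_ / _ *+ K]mulr_natl.
have -> : K%:R ^- 3 / 8 * (K%:R * (K%:R * s2 / B%:R)) = s2 / (8 * B%:R) * K%:R^-1 :> R.
  by field; rewrite !gt_eqF.
(* The drift noise has mean at most s2 / (B K); the factor 1/K is given away to match the constant
   of the theorem. *)
rewrite ler_piMr//; first by rewrite divr_ge0// mulr_ge0// ltW.
by rewrite invf_le1// ler1n.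
Qed.

End NoiseMean.

(** * The convergence bound *)

Theorem theorem1
  (R : realType) (d N K B : nat)
  (dO dX : measure_display) (Om : measurableType dO) (Xi : measurableType dX)
  (P : probability Om R) (D : 'I_N -> probability Xi R)
  (F : 'I_N -> 'rV[R]_d -> Xi -> R) (gF : 'I_N -> 'rV[R]_d -> Xi -> 'rV[R]_d)
  (f : 'I_N -> 'rV[R]_d -> R) (gradf : 'I_N -> 'rV[R]_d -> 'rV[R]_d)
  (h : 'rV[R]_d -> \bar R) (L rho sigma Bh : R)
  (xi : 'I_N -> nat -> nat -> 'I_B -> Om -> Xi)
  (alpha beta : R) (z0 : 'rV[R]_d) (c0 : 'I_N -> 'rV[R]_d) (T : nat) :
  (* N, d, K, B positive integers *)
  (0 < N)%N -> (0 < d)%N -> (0 < K)%N -> (0 < B)%N ->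
  (* f_i(x) = E_{xi ~ D_i}[F_i(x; xi)], gF_i(. ; xi) = grad F_i(. ; xi), gradf_i = grad f_i *)
  (forall i x, (D i).-integrable setT (fun s => (F i x s)%:E) /\
               (f i x)%:E = (\int[D i]_s (F i x s)%:E)%E) ->
  (forall i s, is_gradient (fun x => F i x s) (fun x => gF i x s)) ->
  (forall i, is_gradient (f i) (gradf i)) ->
  let fbar := fun z => (N%:R)^-1 * \sum_(i < N) f i z in
  let phi := fun z => ((fbar z)%:E + h z)%E in
  let phistar := ereal_inf (range phi) in
  (* (A1) *)
  (-oo < phistar)%E ->
  (* (A2) *)
  0 < L ->
  (forall i x y, f i x - f i y - dot (gradf i y) (x - y) <= L / 2 * sqn (x - y)) ->
  (forall i x y, nrm (gradf i x - gradf i y) <= L * nrm (x - y)) ->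
  (* (A3) *)
  0 <= rho -> proper_fun h -> closed_fun h -> weakly_convex rho h ->
  (forall z v, subgrad h z v -> sqn v <= Bh) ->
  (* (A4): fresh i.i.d. samples xi_{i,t,k,b} ~ D_i, unbiased gradients, variance sigma^2
     per sample (hence sigma^2/B for the mini-batch average g_i) *)
  iid_samples K P D xi ->
  (forall i x j, (D i).-integrable setT (fun s => (gF i x s ord0 j)%:E) /\
                 (\int[D i]_s (gF i x s ord0 j)%:E)%E = (gradf i x ord0 j)%:E) ->
  (forall i x, (\int[D i]_s (sqn (gF i x s - gradf i x))%:E <= (sigma ^+ 2)%:E)%E) ->
  (* technical: (x, xi) |-> gradF_i(x; xi) maps measurable inputs to measurable outputs *)
  (forall i (X : Om -> 'rV[R]_d) (Y : Om -> Xi),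
     (forall j, measurable_fun setT (fun w => X w ord0 j)) -> measurable_fun setT Y ->
     forall j, measurable_fun setT (fun w => gF i (X w) (Y w) ord0 j)) ->
  (* initialization and step sizes *)
  \sum_(i < N) c0 i = 0 ->
  (1 <= T)%N -> 0 < alpha -> 0 < beta ->
  0 < alpha * (rho + L) + 4 * alpha ^+ 2 * L ^+ 2 <= 1 / 2 ->
  let delta := ((1 - alpha * rho) ^+ 2)^-1 in
  192 * (6 + delta) * beta ^+ 2 * (K%:R) ^+ 2 * L ^+ 2 <= 1 ->
  let gradfbar := fun z => (N%:R)^-1 *: \sum_(i < N) gradf i z in
  let z_ := fun (t : nat) (w : Om) =>
    (fedcanon K alpha beta h (minibatch_grad gF xi w) z0 c0 t).1 in
  let E0 := (N%:R)^-1 * \sum_(i < N) sqn (gradf i z0 + c0 i - gradfbar z0) in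
  (((T%:R)^-1)%:E *
     \sum_(t < T) 'E_P[fun w => sqn (Gmap alpha h (z_ t w) (gradfbar (z_ t w)))]
   <= 8%:E * (phi z0 - phistar + (alpha * E0)%:E) * ((alpha * T%:R)^-1)%:E
      + (50 * sigma ^+ 2 / (B%:R * K%:R))%:E + (sigma ^+ 2 / (8 * B%:R))%:E + Bh%:E)%E.
Proof.
move=> N0 d0 K0 B0 HF gradF _ fb phi phistar A1 L0 smooth lip rho0 hprop hcl hwc Bhb.
move=> iid gmean gvar _ sumc T1 a0 b0 /andP[_ asmall] delta bsmall.
pose gfb := gradfbar gradf.
pose gs := minibatch_grad gF xi.
pose st t w := fedcanon K alpha beta h (gs w) z0 c0 t.
pose E0 := heterogeneity gradf (z0, c0).
change ((((T%:R^-1)%:E *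
     \sum_(t < T) 'E_P[fun w => sqn (Gmap alpha h (st t w).1 (gfb (st t w).1))]
   <= 8%:E * (phi z0 - phistar + (alpha * E0)%:E) * ((alpha * T%:R)^-1)%:E
      + (50 * sigma ^+ 2 / (B%:R * K%:R))%:E + (sigma ^+ 2 / (8 * B%:R))%:E + Bh%:E)%E)).
have lip2 i x y : sqn (gradf i x - gradf i y) <= L ^+ 2 * sqn (x - y).
  by apply: sqn_le_nrm (ltW L0) (lip i x y).
have mF i x : measurable_fun setT (F i x).
  by apply/measurable_EFinP; exact: measurable_int (HF i x).1.
have a2L2 : 0 <= 4 * alpha ^+ 2 * L ^+ 2 by rewrite mulr_ge0 ?sqr_ge0// mulr_ge0 ?sqr_ge0.
have arho0 : 0 <= alpha * rho by rewrite mulr_ge0// ltW.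
have aL0 : 0 <= alpha * L by rewrite mulr_ge0// ltW.
have aL : alpha * L <= 1 / 2 by move: asmall; rewrite mulrDr; lra.
have arho : alpha * rho <= 1 / 2 by move: asmall; rewrite mulrDr; lra.
have bsmall' : (beta * K%:R * L) ^+ 2 <= 1 / 1344.
  have delta1 : 1 <= delta.
    have p : 0 < 1 - alpha * rho by move: arho; lra.
    have l : 1 - alpha * rho <= 1 by move: arho0; lra.
    by rewrite /delta (invf_ge1 (exprn_gt0 2 p)) (exprn_ile1 2 (ltW p) l).
  have e0 : 0 <= (beta * K%:R * L) ^+ 2 by rewrite sqr_ge0.
  have e : 192 * (6 + delta) * beta ^+ 2 * K%:R ^+ 2 * L ^+ 2
      = 192 * (6 + delta) * (beta * K%:R * L) ^+ 2 by ring.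
  rewrite e in bsmall; move: bsmall e0; move: (_ ^+ 2) => q bsmall q0.
  have : 0 <= q * (delta - 1) by rewrite mulr_ge0// subr_ge0.
  by move: bsmall; clear e; move: delta {delta1} => x; lra.
have [hNy [x1 hx1]] := hprop.
have phis_le x : (phistar <= phi x)%E by apply: ereal_inf_lbound; exists x.
have phis_fin : phistar \is a fin_num.
  rewrite fin_numE gt_eqF//= lt_eqF//; apply: (le_lt_trans (phis_le x1)).
  by rewrite /phi -(fineK hx1) -EFinD ltry.
have [ps psE] : exists ps, phistar = ps%:E by exists (fine phistar); rewrite fineK.
have ps_le x : h x \is a fin_num -> ps <= fine (h x) + fb x.
  move=> hx; have := phis_le x; rewrite psE /phi -(fineK hx) -EFinD lee_fin.
  by rewrite addrC.
(* The minorant of [h] around y: [h x >= ps - fb x], and smoothness bounds [fb x] above by its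
   quadratic model at y. *)
have prox_min y x : (prox_obj h alpha y (prox alpha h y) <= prox_obj h alpha y x)%E.
  apply: (prox_objP a0 (g := gfb y) (b := ps - fb y) (L := L)) => // {}x.
  have sm : fb x - fb y - dot (gfb y) (x - y) <= L / 2 * sqn (x - y).
    exact: fbar_smooth.
  case hx : (h x) => [r| |]; [|by rewrite leey|by have := hNy x; rewrite hx].
  have := ps_le x; rewrite hx => /(_ isT) /= psx.
  rewrite lee_fin; move: sm psx.
  move: (fb x) (fb y) (L / 2 * _) (dot _ _) => a b p q {asmall bsmall bsmall' aL arho}; lra.
have Bh0 : 0 <= Bh.
  apply: le_trans (Bhb _ _ (prox_subgrad a0 hprop prox_min z0)).
  exact: sqn_ge0.
have T0 : 0 < T%:R :> R by rewrite ltr0n.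
(* If [h z0] is infinite, so is the right-hand side. *)
case hz0 : (h z0 \is a fin_num); last first.
  have phi_pinfty : phi z0 = +oo%E.
    by move: hz0 (hNy z0); rewrite /phi; case: (h z0) => // _ _; rewrite addey.
  rewrite phi_pinfty psE addye// gt0_muley// gt0_mulye.
    by rewrite !addye// leey.
  by rewrite lte_fin invr_gt0 mulr_gt0.
have prox_lip := prox_lipschitz4 a0 L0 asmall hprop hwc prox_min.
pose nu := 50 * (sigma ^+ 2 / (B%:R * K%:R)) + sigma ^+ 2 / (8 * B%:R).
have mnoise t : mean_le P (fun w => round_noise K beta gradf (gs w) t (st t w)) nu.
  exact: (round_noise_mean_le beta B0 gradF mF lip2 prox_lip iid gmean gvar).
have mst t : vec_measurable (fun w => (st t w).1).
  exact: (fedcanon_state_measurable beta gradF mF prox_lip iid z0 c0 t).1.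
pose G t w := sqn (Gmap alpha h (st t w).1 (gfb (st t w).1)).
have mG t : measurable_fun setT (G t).
  apply: sqn_measurable; apply: vec_measurableZ; apply: vec_measurableB => //.
  apply: (vec_measurable_lipschitz prox_lip); apply: vec_measurableB => //.
  apply: vec_measurableZ; apply: (vec_measurable_lipschitz (gradfbar_lip N0 lip2)).
  exact: mst.
have psE0 : ps <= fine (h z0) + fb z0 by exact: ps_le.
have E00 : 0 <= E0 by exact: heterogeneity_ge0.
pose Cst := 8 / alpha * (fine (h z0) + fb z0 + alpha / 16 * E0 - ps) + T%:R * Bh.
have Cst0 : 0 <= Cst.
  rewrite addr_ge0 ?mulr_ge0 ?invr_ge0 ?ler0n// ?(ltW a0)// subr_ge0.
  by rewrite (le_trans psE0)// lerDl mulr_ge0// mulr_ge0 ?(ltW a0)// invr_ge0.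
have pathwise w : \sum_(t < T) G t w
    <= Cst + \sum_(t < T) round_noise K beta gradf (gs w) t (st t w).
  have [_ hT H] := fedcanon_descent (gs w) N0 K0 a0 b0 L0 lip2 smooth bsmall' asmall
    hprop hwc prox_min Bhb T sumc hz0.
  apply: (le_trans H); rewrite /Cst addrAC lerD2r lerD2r ler_pM2l ?divr_gt0//.
  rewrite /lyapunov lerB// (le_trans (ps_le _ hT))// lerDl.
  by rewrite mulr_ge0 ?heterogeneity_ge0// mulr_ge0 ?(ltW a0)// invr_ge0.
have [mS S0 SB] := mean_leD (mean_le_cst P Cst0) (mean_le_sum (index_enum 'I_T) mnoise).
have sumG : (\sum_(t < T) 'E_P[G t] <= (Cst + T%:R * nu)%:E)%E.
  have -> : (\sum_(t < T) 'E_P[G t] = \int[P]_w (\sum_(t < T) G t w)%:E)%E.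
    under [RHS]eq_integral do rewrite -sumEFin.
    rewrite ge0_integral_sum//.
    - by apply: eq_bigr => t _; rewrite unlock.
    - by move=> t; apply/measurable_EFinP.
    - by move=> t w _; rewrite lee_fin sqn_ge0.
  have -> : T%:R * nu = \sum_(t < T) nu by rewrite sumr_const card_ord mulr_natl.
  apply: le_trans SB; apply: ge0_le_integral => //.
  - by move=> w _; rewrite lee_fin sumr_ge0// => t _; exact: sqn_ge0.
  - by apply/measurable_EFinP; apply: measurable_sum => t; exact: mG.
  - exact/measurable_EFinP.
  - by move=> w _; rewrite lee_fin.
apply: (@le_trans _ _ ((T%:R^-1)%:E * (Cst + T%:R * nu)%:E)%E).
  by apply: lee_wpmul2l; [rewrite lee_fin invr_ge0 ltW|exact: sumG].
rewrite psE /phi -(fineK hz0) -!EFinD lee_fin.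
(* The theorem allots 8 E0 / T to the initial heterogeneity, the Lyapunov weight 1/16 uses E0 / (2
   T); the difference is 15/2. *)
rewrite -subr_ge0 (_ : _ - _ = 15 / 2 * (T%:R^-1 * E0)).
  apply: mulr_ge0; first by rewrite divr_ge0.
  by apply: mulr_ge0 => //; rewrite invr_ge0 ltW.
rewrite /Cst /nu -/(fb z0); field.
by rewrite !gt_eqF// ltr0n.
Qed.
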